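(* Consider the double input-double output Mix with arrival rates $\lambda_R>\lambda_B$ as described in the context, and let $$\rho=\frac{\lambda_B(1-\lambda_R)}{\lambda_R(1-\lambda_B)}.$$ Then a threshold policy is optimal, in the sense that it minimizes the average queue size among all maximum throughput policies with perfect anonymity. Moreover, the (optimal) threshold is given by $$m^*=\begin{cases}\left\lceil -\dfrac{1}{\log_2\rho}\right\rceil-1, & \tfrac12<\rho<1,\\[2mm] 0, & 0\le\rho\le\tfrac12.\end{cases}$$
   Context: **Model.** Time is slotted. A Mix has two input links and two output links, each of capacity 1 packet/slot. In each slot a red packet arrives with probability $\lambda_R$ and a blue packet arrives with probability $\lambda_B$, independently of each other and across slots, where $\lambda_R>\lambda_B$. Within each slot, arrivals occur first and then departures. Red and blue packets are stored in two separate queues, initially empty. All red packets leave through output link $d_R\in\{1,2\}$ and all blue packets through the other output link; $d_R$ is uniform on $\{1,2\}$ and independent of the arrivals. The Mix may drop packets; there is no per-packet delay constraint. Policies may be randomized and are causal. **Perfect anonymity.** Let $I_R^{(N)},I_B^{(N)}$ be the red and blue arrival sequences in the first $N$ slots and $G_i^{(N)}=(G_i(1),\dots,G_i(N))$, $i=1,2$, with $G_i(t)\in\{0,1\}$ indicating whether a packet is transmitted on output $i$ in slot $t$. The anonymity of a policy $\psi$ is $A^\psi=\lim_{N\to\infty}H(d_R\mid I_R^{(N)},I_B^{(N)},G_1^{(N)},G_2^{(N)})$ (Shannon conditional entropy in bits); perfect anonymity means $A^\psi=1$. **Maximum throughput.** The throughput of a flow is the long-run average number of its packets transmitted per slot.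 The maximum throughput compatible with anonymity is $\min\{\lambda_R,\lambda_B\}=\lambda_B$ for each flow; a maximum throughput policy is one under which each flow has throughput $\lambda_B$ (so red packets are dropped at average rate $\lambda_R-\lambda_B$). **Average queue size.** The long-run time average of the expected total number of packets in the two queues (at slot ends); for stationary policies with a steady state, the steady-state mean of this number. **Policies described by drop probabilities.** Given $\delta_x\in[0,1]$, $x=0,1,2,\dots$, consider the policy that, whenever a red and a blue packet are both available, immediately transmits one red and one blue packet simultaneously, and which drops a red packet with probability $\delta_x$ when there are $x$ red packets and no blue packets in the queues and a slot brings a red arrival but no blue arrival (and drops nothing otherwise). Writing $(i,j)$ for the state with $i$ packets in the red queue and $j$ packets in the blue queue, only states $(x,0)$ and $(0,y)$ occur, and the state is a Markov chain with transition probabilities, for $y\ge1$, $$P[(0,y)|(0,y)]=\lambda_R\lambda_B+(1-\lambda_R)(1-\lambda_B),\quad P[(0,y-1)|(0,y)]=\lambda_R(1-\lambda_B),\quad P[(0,y+1)|(0,y)]=\lambda_B(1-\lambda_R),$$ and, for $x\ge1$, $$P[(x,0)|(x,0)]=\lambda_R\lambda_B+(1-\lambda_R)(1-\lambda_B)+\lambda_R(1-\lambda_B)\delta_x,$$ $$P[(x-1,0)|(x,0)]=\lambda_B(1-\lambda_R),\quad P[(x+1,0)|(x,0)]=\lambda_R(1-\lambda_B)(1-\delta_x);$$ from $(0,0)$ the chain moves to $(0,1)$ with probability $\lambda_B(1-\lambda_R)$, to $(1,0)$ with probability $\lambda_R(1-\lambda_B)(1-\delta_0)$, and otherwise stays.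 **Threshold policy.** For a nonnegative integer $m$, the threshold policy with threshold $m$ is such a policy with $\delta_x=0$ for all $0\le x\le m-1$ and $\delta_m=1$. *)

(* Defs.v *)
From mathcomp Require Import all_boot all_order all_algebra.
From mathcomp Require Import all_classical all_reals all_analysis.

Set Implicit Arguments.
Unset Strict Implicit.
Unset Printing Implicit Defensive.

Import Order.TTheory GRing.Theory Num.Theory.
Import numFieldNormedType.Exports.

Local Open Scope ring_scope.

(* What the Mix does in one slot: whether it transmits a red / a blue packet,
   and how many red / blue packets it drops. *)
Definition action := (bool * bool * nat * nat)%type.
Definition sent_red (u : action) : bool := u.1.1.1.
Definition sent_blue (u : action) : bool := u.1.1.2.
Definition dropped_red (u : action) : nat := u.1.2.
Definition dropped_blue (u : action) : nat := u.2.

(* One slot: red arrival, blue arrival, action.  A history lists the past slots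
   in chronological order. *)
Definition slot := (bool * bool * action)%type.
Definition arr_red (s : slot) : bool := s.1.1.
Definition arr_blue (s : slot) : bool := s.1.2.
Definition act (s : slot) : action := s.2.
Definition history := seq slot.

(* Queue contents at the end of a history, starting from empty queues.  The
   truncated subtraction is exact on histories whose actions are feasible. *)
Definition red_queue (h : history) : nat :=
  (\sum_(s <- h) arr_red s
   - \sum_(s <- h) (sent_red (act s) + dropped_red (act s)))%N.
Definition blue_queue (h : history) : nat :=
  (\sum_(s <- h) arr_blue s
   - \sum_(s <- h) (sent_blue (act s) + dropped_blue (act s)))%N.

(* Arrivals precede departures, so packets of the current slot may leave. *)
Definition feasible (h : history) (aR aB : bool) (u : action) : bool :=
  (sent_red u + dropped_red u <= red_queue h + aR)%N &&
  (sent_blue u + dropped_blue u <= blue_queue h + aB)%N.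

Section Mix.
Context {R : realType}.

(* Sum over a finite set of actions containing all the feasible ones. *)
Definition sum_actions (h : history) (aR aB : bool) (F : action -> R) : R :=
  \sum_(sR : bool) \sum_(sB : bool)
   \sum_(i < (red_queue h + aR).+1) \sum_(j < (blue_queue h + aB).+1)
     F (sR, sB, nat_of_ord i, nat_of_ord j).

(* A randomized causal policy: pol d h aR aB u is the conditional probability
   of the action u given the routing d (true when d_R = 1, false when d_R = 2),
   the past slots h and the arrivals aR, aB of the current slot. *)
Definition policy := bool -> history -> bool -> bool -> action -> R.

Definition is_policy (pol : policy) : Prop :=
  forall (d : bool) (h : history) (aR aB : bool),
    [/\ forall u, 0 <= pol d h aR aB u,
        forall u, ~~ feasible h aR aB u -> pol d h aR aB u = 0
      & sum_actions h aR aB (pol d h aR aB) = 1].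

Section Dynamics.
Variables (lambdaR lambdaB : R) (pol : policy).

(* Conditional expectation of f (history after one more slot) given h and d. *)
Definition next_slot (d : bool) (f : history -> R) (h : history) : R :=
  \sum_(aR : bool) \sum_(aB : bool)
    bernoulli_pmf lambdaR aR * bernoulli_pmf lambdaB aB *
    sum_actions h aR aB (fun u => pol d h aR aB u * f (rcons h (aR, aB, u))).

(* E[f(H_n) | d_R], where H_n is the history of the first n slots. *)
Fixpoint cond_expect (d : bool) (n : nat) (f : history -> R) : R :=
  if n is n'.+1 then cond_expect d n' (next_slot d f) else f [::].

(* E[f(H_n)], with d_R uniform and independent of the arrivals. *)
Definition expect (n : nat) (f : history -> R) : R :=
  2^-1 * \sum_(d : bool) cond_expect d n f.

Definition mean_sent_red (n : nat) : R :=
  expect n (fun h => (\sum_(s <- h) sent_red (act s))%:R) / n%:R.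
Definition mean_sent_blue (n : nat) : R :=
  expect n (fun h => (\sum_(s <- h) sent_blue (act s))%:R) / n%:R.

Definition max_throughput : Prop :=
  (mean_sent_red n @[n --> \oo] --> lambdaB)%classic /\
  (mean_sent_blue n @[n --> \oo] --> lambdaB)%classic.

(* Expected total queue size at slot ends, averaged over the first n slots. *)
Definition mean_queue (n : nat) : R :=
  (\sum_(t < n) expect t.+1 (fun h => (red_queue h + blue_queue h)%:R)) / n%:R.

End Dynamics.

Definition log2 (x : R) : R := ln x / ln 2.

(* H(X | Y) in bits for the joint probability mass function p of (X, Y); the
   terms with p x y = 0 vanish. *)
Definition cond_entropy (X Y : finType) (p : X -> Y -> R) : R :=
  - \sum_(x : X) \sum_(y : Y) p x y * log2 (p x y / \sum_(x' : X) p x' y).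

(* The eavesdropper's view (I_R, I_B, G_1, G_2) of one slot. *)
Definition view (d : bool) (s : slot) : bool * bool * bool * bool :=
  (arr_red s, arr_blue s,
   if d then sent_red (act s) else sent_blue (act s),
   if d then sent_blue (act s) else sent_red (act s)).

Definition joint_pmf (lambdaR lambdaB : R) (pol : policy) (n : nat)
    (d : bool) (y : n.-tuple (bool * bool * bool * bool)) : R :=
  2^-1 * cond_expect lambdaR lambdaB pol d n
           (fun h => (map (view d) h == y :> seq _)%:R).

Definition perfect_anonymity (lambdaR lambdaB : R) (pol : policy) : Prop :=
  (cond_entropy (@joint_pmf lambdaR lambdaB pol n) @[n --> \oo] --> (1 : R))
    %classic.

Definition admissible (lambdaR lambdaB : R) (pol : policy) : Prop :=
  [/\ is_policy pol, max_throughput lambdaR lambdaB pol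
    & perfect_anonymity lambdaR lambdaB pol].

(* The average queue size q of pol is a genuine limit.  The time averages of a
   competing policy need not converge; comparing q with their lower limit
   covers every reading of "long-run average" for such a policy. *)
Definition minimizes_average_queue (lambdaR lambdaB : R) (pol : policy) : Prop :=
  admissible lambdaR lambdaB pol /\
  exists2 q : R,
    (mean_queue lambdaR lambdaB pol n @[n --> \oo] --> q)%classic &
    forall pol' : policy, admissible lambdaR lambdaB pol' ->
      (q%:E <= limn_einf (fun n => (mean_queue lambdaR lambdaB pol' n)%:E))%E.

(* The policy with drop probabilities delta. *)
Definition drop_policy (delta : nat -> R) : policy := fun _ h aR aB u =>
  let both := (0 < red_queue h + aR)%N && (0 < blue_queue h + aB)%N in
  let p := if [&& blue_queue h == 0%N, aR & ~~ aB]
           then delta (red_queue h) else 0 in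
  (1 - p) * (u == (both, both, 0%N, 0%N))%:R
  + p * (u == (both, both, 1%N, 0%N))%:R.

(* The values of delta above m are arbitrary: more than m red packets are never
   queued. *)
Definition threshold_probabilities (m : nat) (delta : nat -> R) : Prop :=
  [/\ forall x, 0 <= delta x <= 1, forall x, (x < m)%N -> delta x = 0
    & delta m = 1].

Definition rho (lambdaR lambdaB : R) : R :=
  (lambdaB * (1 - lambdaR)) / (lambdaR * (1 - lambdaB)).

Definition optimal_threshold (r : R) : int :=
  if 2^-1 < r then Num.ceil (- (1 / log2 r)) - 1 else 0.

End Mix.

(* Main.v *)
Require Import Defs.
From mathcomp Require Import all_boot all_order all_algebra.
From mathcomp Require Import all_classical all_reals all_analysis.
From mathcomp Require Import ring lra zify.

Set Implicit Arguments.
Unset Strict Implicit.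
Unset Printing Implicit Defensive.

Import Order.TTheory GRing.Theory Num.Theory.
Import numFieldNormedType.Exports.
Local Open Scope ring_scope.

(* Lower bound.  Entropy at most 1 - O(|p_true - p_false|^2) forces the views of
   the eavesdropper to have the same law under both routings, so the red packets
   sent in one world and the blue packets sent in the other have the same law
   given the arrivals.  Pair the red queue x of one world with the blue queue y
   of the other and couple the two histories independently given their common
   view: z = x - y then moves by (red arrival) - (blue arrival) - (red drops)
   + (blue drops), and x + y >= |z|.  A nondecreasing function g of z satisfying
   q + E g(z + arrivals) <= |z| + g(z) bounds the average of x + y below by q up
   to two errors.  Blue drops cost O(1) each and are o(n) in expectation, because
   blue has throughput lambdaB.  The coupling must also be updated when the view
   of the next slot reveals information on the past blue drops D; the squared
   increments of P(D >= j | view) telescope, and sum over j and over time to at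
   most 1 + E D = o(n).
   Both errors need slopes of g with finite support, so the solution of the
   Poisson equation for the threshold m is truncated far away.
   Upper bound.  For the threshold policy z is a Markov chain for which the
   Poisson equation is exact. *)

(** * Finitely supported positive functionals and conditional couplings *)

Section Finitary.
Context {R : realType}.
Implicit Types (P Q : history -> Prop) (F G : (history -> R) -> R).

(** Expectations are handled as finite positive combinations of point evaluations. Strict positivity
    of the weights makes the view of every atom an event of positive probability. *)
Definition finitary P F : Prop :=
  exists2 l : seq (R * history),
    forall w, w \in l -> 0 < w.1 /\ P w.2 &
    forall f, F f = \sum_(w <- l) w.1 * f w.2.

Lemma finitary_dirac P h : P h -> finitary P (fun f => f h).
Proof.
move=> Ph; exists [:: (1, h)] => [w|f]; last by rewrite big_seq1 mul1r.
by rewrite inE => /eqP ->.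
Qed.

(** Asking for [finitary P F] only when [c != 0] exempts actions of probability zero from preserving
    [P]. *)
Lemma finitary_scale P F (c : R) :
  0 <= c -> (c != 0 -> finitary P F) -> finitary P (fun f => c * F f).
Proof.
move=> c0 PF; have [->|cN0] := eqVneq c 0.
  by exists [::] => // f; rewrite mul0r big_nil.
have [l lP lE] := PF cN0; exists [seq (c * w.1, w.2) | w <- l] => [w|f].
  case/mapP=> w' /lP[w'0 Pw'] ->; split => //=.
  by rewrite mulr_gt0 // lt0r cN0.
by rewrite lE big_map big_distrr; apply: eq_bigr => w _; rewrite /= mulrA.
Qed.

Lemma finitary_sum (I : eqType) (r : seq I) P (F : I -> (history -> R) -> R) :
  (forall i, i \in r -> finitary P (F i)) ->
  finitary P (fun f => \sum_(i <- r) F i f).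
Proof.
elim: r => [|i r IH] PF.
  by exists [::] => // f; rewrite !big_nil.
have [l lP lE] := PF i (mem_head i r).
have [l' lP' lE'] := IH (fun j jr => PF j (mem_behead (s := i :: r) jr)).
exists (l ++ l') => [w|f].
  by rewrite mem_cat => /orP[/lP|/lP'].
by rewrite big_cons lE lE' big_cat.
Qed.

Section Functional.
Variables (P : history -> Prop) (F : (history -> R) -> R).
Hypothesis finF : finitary P F.

Lemma finitary_le f g : (forall h, P h -> f h <= g h) -> F f <= F g.
Proof.
case: finF => l lP lE fg; rewrite !lE big_seq [leRHS]big_seq.
apply: ler_sum => w /lP[w0 Pw]; rewrite ler_pM2l //; exact: fg.
Qed.

Lemma finitary_eq f g : (forall h, P h -> f h = g h) -> F f = F g.
Proof.
by move=> fg; apply/eqP; rewrite eq_le !finitary_le // => h Ph; rewrite fg.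
Qed.

Lemma finitaryD f g : F (fun h => f h + g h) = F f + F g.
Proof.
case: finF => l _ lE; rewrite !lE -big_split.
by apply: eq_bigr => w _; rewrite mulrDr.
Qed.

Lemma finitaryZ c f : F (fun h => c * f h) = c * F f.
Proof.
case: finF => l _ lE; rewrite !lE big_distrr.
by apply: eq_bigr => w _; rewrite mulrCA.
Qed.

Lemma finitaryZr c f : F (fun h => f h * c) = F f * c.
Proof.
by rewrite mulrC -finitaryZ; apply: finitary_eq => h _; rewrite mulrC.
Qed.

Lemma finitaryB f g : F (fun h => f h - g h) = F f - F g.
Proof.
rewrite -mulN1r -finitaryZ -finitaryD.
by apply: finitary_eq => h _; rewrite mulN1r.
Qed.

Lemma finitary_bigsum (I : Type) (r : seq I) (f : I -> history -> R) :
  F (fun h => \sum_(i <- r) f i h) = \sum_(i <- r) F (f i).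
Proof.
case: finF => l _ lE; rewrite lE.
under eq_bigr do rewrite big_distrr /=.
by rewrite exchange_big; apply: eq_bigr => i _; rewrite lE.
Qed.

End Functional.

Lemma finitary_exchange P Q F G (k : history -> history -> R) :
  finitary P F -> finitary Q G ->
  F (fun h => G (fun h' => k h h')) = G (fun h' => F (fun h => k h h')).
Proof.
move=> finF [l lP lE]; rewrite lE.
under [in RHS]eq_bigr do rewrite -(finitaryZ finF).
rewrite -(finitary_bigsum finF); apply: (finitary_eq finF) => h _.
exact: lE.
Qed.

Section Coupling.
Variables (V : eqType) (P1 P0 : history -> Prop).
Variables (F1 F0 : (history -> R) -> R) (v1 v0 : history -> V).
Hypotheses (finF1 : finitary P1 F1) (finF0 : finitary P0 F0).
Hypothesis same_view : forall v, F1 (fun h => (v1 h == v)%:R) = F0 (fun h => (v0 h == v)%:R).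

Let prob v := F1 (fun h => (v1 h == v)%:R).

(* 0 when the view v has probability 0. *)
Definition cnd (f : history -> R) (v : V) : R :=
  F0 (fun h => (v0 h == v)%:R * f h) / F0 (fun h => (v0 h == v)%:R).

(* Expectation when h1 and h0 are conditionally independent given their
   common view. *)
Definition coupling (k : history -> history -> R) : R :=
  F1 (fun h1 => cnd (k h1) (v1 h1)).

(** Equality of the laws of the views rewrites the quotient as a single [F0]-expectation, from which
    [cnd] inherits linearity. *)
Lemma cndE f v : cnd f v = F0 (fun h => (v0 h == v)%:R / prob v * f h).
Proof.
rewrite /cnd -same_view -(finitaryZr finF0).
by apply: (finitary_eq finF0) => h _; rewrite mulrAC.
Qed.

Lemma coupling_le k k' :
  (forall h1 h0, P1 h1 -> P0 h0 -> v1 h1 = v0 h0 -> k h1 h0 <= k' h1 h0) ->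
  coupling k <= coupling k'.
Proof.
move=> kk'; apply: (finitary_le finF1) => h1 P1h1; rewrite !cndE.
apply: (finitary_le finF0) => h0 P0h0.
have [e|] := eqVneq (v0 h0) (v1 h1); last by rewrite !mul0r.
rewrite ler_wpM2l ?kk' // mul1r invr_ge0 /prob.
case: finF1 => l lP ->; rewrite big_seq sumr_ge0 // => w /lP[w0 _].
by rewrite mulr_ge0 // ltW.
Qed.

Lemma coupling_eq k k' :
  (forall h1 h0, P1 h1 -> P0 h0 -> v1 h1 = v0 h0 -> k h1 h0 = k' h1 h0) ->
  coupling k = coupling k'.
Proof.
move=> kk'; apply/eqP; rewrite eq_le !coupling_le // => h1 h0 ? ? ?.
all: by rewrite kk'.
Qed.

Lemma cndD f g v : cnd (fun h => f h + g h) v = cnd f v + cnd g v.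
Proof.
rewrite !cndE -(finitaryD finF0).
by apply: (finitary_eq finF0) => h _; rewrite mulrDr.
Qed.

Lemma cndZ c f v : cnd (fun h => c * f h) v = c * cnd f v.
Proof.
rewrite !cndE -(finitaryZ finF0).
by apply: (finitary_eq finF0) => h _; rewrite mulrCA.
Qed.

Lemma cndB f g v : cnd (fun h => f h - g h) v = cnd f v - cnd g v.
Proof.
rewrite -mulN1r -cndZ -cndD.
by rewrite !cndE; apply: (finitary_eq finF0) => h _; rewrite mulN1r.
Qed.

Lemma cnd_bigsum (I : Type) (r : seq I) (f : I -> history -> R) v :
  cnd (fun h => \sum_(i <- r) f i h) v = \sum_(i <- r) cnd (f i) v.
Proof.
under [in RHS]eq_bigr do rewrite cndE.
rewrite cndE -(finitary_bigsum finF0).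
by apply: (finitary_eq finF0) => h _; rewrite big_distrr.
Qed.

Lemma cnd_le f g v : (forall h, P0 h -> v0 h = v -> f h <= g h) -> cnd f v <= cnd g v.
Proof.
move=> fg; rewrite /cnd ler_wpM2r //.
  rewrite invr_ge0; case: finF0 => l lP ->; rewrite big_seq sumr_ge0 // => w.
  by case/lP=> w0 _; rewrite mulr_ge0 // ltW.
apply: (finitary_le finF0) => h Ph.
by have [e|] := eqVneq (v0 h) v; rewrite ?mul0r // !mul1r fg.
Qed.

Lemma couplingD k k' : coupling (fun h1 h0 => k h1 h0 + k' h1 h0) = coupling k + coupling k'.
Proof.
by rewrite -(finitaryD finF1); apply: (finitary_eq finF1) => h _; rewrite cndD.
Qed.

Lemma couplingB k k' : coupling (fun h1 h0 => k h1 h0 - k' h1 h0) = coupling k - coupling k'.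
Proof.
by rewrite -(finitaryB finF1); apply: (finitary_eq finF1) => h _; rewrite cndB.
Qed.

Lemma prob_gt0_sum (F : (history -> R) -> R) (l : seq (R * history)) (v : history -> V) w :
  (forall w, w \in l -> 0 < w.1) -> (forall f, F f = \sum_(w <- l) w.1 * f w.2) ->
  w \in l -> 0 < F (fun h => (v h == v w.2)%:R).
Proof.
move=> l0 lE wl; rewrite lE (big_rem w) //= eqxx mulr1.
rewrite ltr_pwDl ?l0 // big_seq sumr_ge0 // => w' /mem_rem /l0 /ltW w'0.
by rewrite mulr_ge0.
Qed.

(** The view of an atom of [F1] has positive probability under [F1], hence under [F0], so
    conditioning on it yields total mass one. *)
Lemma coupling_l f : coupling (fun h1 _ => f h1) = F1 f.
Proof.
rewrite /coupling; case: (finF1) => l lP lE; rewrite !lE.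
rewrite big_seq [RHS]big_seq; apply: eq_bigr => w wl; congr (_ * _).
rewrite cndE (finitaryZr finF0) (finitaryZr finF0) -same_view mulfV ?mul1r //.
by rewrite gt_eqF // (prob_gt0_sum (l := l)) // => w' /lP[].
Qed.

(** On pairs with a common view the weight may be normalized by the view of either history. After
    exchanging the two expectations, each atom of [F0] receives mass one. *)
Lemma coupling_r f : coupling (fun _ h0 => f h0) = F0 f.
Proof.
have -> : coupling (fun _ => f) =
    F1 (fun h1 => F0 (fun h0 => (v1 h1 == v0 h0)%:R / prob (v0 h0) * f h0)).
  apply: (finitary_eq finF1) => h1 _; rewrite cndE.
  apply: (finitary_eq finF0) => h0 _; rewrite [in RHS]eq_sym.
  by have [->|] := eqVneq (v0 h0) (v1 h1); rewrite ?mul0r.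
rewrite (finitary_exchange _ finF1 finF0); case: (finF0) => l lP lE; rewrite !lE.
rewrite big_seq [RHS]big_seq; apply: eq_bigr => w wl; congr (_ * _).
rewrite (finitaryZr finF1) (finitaryZr finF1) mulfV ?mul1r //.
by rewrite gt_eqF // same_view (prob_gt0_sum (l := l)) // => w' /lP[].
Qed.

End Coupling.

(** Couple [F] with itself: a function of the common view can be evaluated at either history, and
    the second marginal is [F]. *)
Lemma tower (V : eqType) P F (v : history -> V) (f : history -> R) (g : V -> R) :
  finitary P F -> F (fun h => cnd F v f (v h) * g (v h)) = F (fun h => f h * g (v h)).
Proof.
move=> finF; rewrite -[RHS](coupling_r (v1 := v) (v0 := v) finF finF) //.
apply: (finitary_eq finF) => h Ph.
rewrite mulrC -(cndZ (F1 := F) (v1 := v) finF) //.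
rewrite /cnd; congr (_ / _); apply: (finitary_eq finF) => h' _.
by have [->|_] := eqVneq (v h') (v h); rewrite ?mul0r // [g _ * _]mulrC.
Qed.

End Finitary.

(** * Dynamics *)

Definition total (f : slot -> nat) (h : history) : nat := (\sum_(s <- h) f s)%N.

Lemma total_rcons f h s : total f (rcons h s) = (total f h + f s)%N.
Proof. by rewrite /total big_rcons /= addnC. Qed.

Lemma total_le_size (f : slot -> bool) h : (total f h <= size h)%N.
Proof.
rewrite -sum1_size; apply: leq_sum => s _; exact: leq_b1.
Qed.

Definition sentR (s : slot) : nat := sent_red (act s).
Definition sentB (s : slot) : nat := sent_blue (act s).
Definition dropR (s : slot) : nat := dropped_red (act s).
Definition dropB (s : slot) : nat := dropped_blue (act s).

(** On these histories the truncated subtractions in the queue contents are exact. *)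
Definition conserving (h : history) : Prop :=
  (total sentR h + total dropR h <= total arr_red h)%N /\
  (total sentB h + total dropB h <= total arr_blue h)%N.

Lemma red_queueE h : red_queue h = (total arr_red h - (total sentR h + total dropR h))%N.
Proof. by rewrite /red_queue /total -big_split. Qed.

Lemma blue_queueE h : blue_queue h = (total arr_blue h - (total sentB h + total dropB h))%N.
Proof. by rewrite /blue_queue /total -big_split. Qed.

Lemma conserving_rcons h aR aB u :
  conserving h -> feasible h aR aB u -> conserving (rcons h (aR, aB, u)).
Proof.
rewrite /conserving !total_rcons /feasible red_queueE blue_queueE.
rewrite /sentR /dropR /sentB /dropB /arr_red /arr_blue /act /=.
by move=> [hR hB] /andP[uR uB]; split; lia.
Qed.

Section Dynamics.
Context {R : realType}.
Variables (lambdaR lambdaB : R) (pol : policy (R := R)).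
Hypotheses (lR01 : 0 <= lambdaR <= 1) (lB01 : 0 <= lambdaB <= 1).
Hypothesis polP : is_policy pol.

Local Notation E d n := (cond_expect lambdaR lambdaB pol d n).

Definition mean_arrivals (g : bool -> bool -> R) : R :=
  \sum_(aR : bool) \sum_(aB : bool)
    bernoulli_pmf lambdaR aR * bernoulli_pmf lambdaB aB * g aR aB.

Lemma mean_arrivalsE g : mean_arrivals g =
  lambdaR * lambdaB * g true true + lambdaR * (1 - lambdaB) * g true false
  + (1 - lambdaR) * lambdaB * g false true
  + (1 - lambdaR) * (1 - lambdaB) * g false false.
Proof. rewrite /mean_arrivals !big_bool /= /bernoulli_pmf; ring. Qed.

Lemma pol_ge0 d h aR aB u : 0 <= pol d h aR aB u.
Proof. by case: (polP d h aR aB). Qed.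

Lemma pol_feasible d h aR aB u : pol d h aR aB u != 0 -> feasible h aR aB u.
Proof. by case: (polP d h aR aB) => _ inf _; apply: contraNT => /inf ->. Qed.

Lemma bernoulli_weight_ge0 aR aB :
  0 <= bernoulli_pmf lambdaR aR * bernoulli_pmf lambdaB aB.
Proof. by move: lR01 lB01 => /andP[? ?] /andP[? ?]; rewrite mulr_ge0 ?bernoulli_pmf_ge0 //; apply/andP. Qed.

Lemma finitary_next_slot (P : history -> Prop) d h :
  (forall aR aB u, pol d h aR aB u != 0 -> P (rcons h (aR, aB, u))) ->
  finitary P (fun f => next_slot lambdaR lambdaB pol d f h).
Proof.
move=> Pr; rewrite /next_slot /sum_actions.
apply: finitary_sum => aR _; apply: finitary_sum => aB _.
apply: finitary_scale => [|_]; first exact: bernoulli_weight_ge0.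
apply: finitary_sum => sR _; apply: finitary_sum => sB _.
apply: finitary_sum => i _; apply: finitary_sum => j _.
apply: finitary_scale => [|u0]; first exact: pol_ge0.
by apply: finitary_dirac; apply: Pr.
Qed.

Lemma finitary_cond_expect (P : history -> Prop) d n :
  P [::] ->
  (forall h aR aB u, P h -> pol d h aR aB u != 0 -> P (rcons h (aR, aB, u))) ->
  finitary (fun h => P h /\ size h = n) (E d n).
Proof.
move=> P0 PS; elim: n => [|n [l lP lE]] /=; first exact: finitary_dirac.
suff: finitary (fun h => P h /\ size h = n.+1)
        (fun f => \sum_(w <- l) w.1 * next_slot lambdaR lambdaB pol d f w.2).
  by case=> l' ? l'E; exists l' => // f; rewrite lE.
apply: finitary_sum => w /lP[w0 [Pw sw]]; apply: finitary_scale => [|_].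
  exact: ltW.
apply: finitary_next_slot => aR aB u u0.
by rewrite size_rcons sw; split => //; apply: PS.
Qed.

Lemma finitary_conserving d n : finitary (fun h => conserving h /\ size h = n) (E d n).
Proof.
apply: finitary_cond_expect; first by rewrite /conserving /total !big_nil.
by move=> h aR aB u hc /pol_feasible; apply: conserving_rcons.
Qed.

(** The probabilities of the actions sum to one, so an [f] that depends on the new slot through its
    arrivals only is averaged over the arrivals alone. *)
Lemma next_slot_arrivals d f g h :
  (forall aR aB u, pol d h aR aB u != 0 -> f (rcons h (aR, aB, u)) = g aR aB) ->
  next_slot lambdaR lambdaB pol d f h = mean_arrivals g.
Proof.
move=> fg; apply: eq_bigr => aR _; apply: eq_bigr => aB _; congr (_ * _).
have [_ _ s1] := polP d h aR aB; rewrite -[RHS]mul1r -s1 /sum_actions.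
rewrite big_distrl; apply: eq_bigr => sR _ /=.
rewrite big_distrl; apply: eq_bigr => sB _ /=.
rewrite big_distrl; apply: eq_bigr => i _ /=.
rewrite big_distrl; apply: eq_bigr => j _ /=.
by have [->|/fg ->//] := eqVneq (pol d h aR aB (sR, sB, nat_of_ord i, nat_of_ord j)) 0; rewrite !mul0r.
Qed.

Lemma cond_expect_cst d n (c : R) : E d n (fun _ => c) = c.
Proof.
elim: n => //= n IH; rewrite -[RHS]IH; apply: (finitary_eq (finitary_conserving d n)) => h _.
by rewrite (@next_slot_arrivals _ _ (fun _ _ => c)) // mean_arrivalsE; ring.
Qed.

Lemma cond_expect_arrivals d n f g :
  (forall h aR aB u, conserving h -> size h = n -> feasible h aR aB u ->
     f (rcons h (aR, aB, u)) = g h aR aB) ->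
  E d n.+1 f = E d n (fun h => mean_arrivals (g h)).
Proof.
move=> fg; apply: (finitary_eq (finitary_conserving d n)) => h [hc hn].
by apply: next_slot_arrivals => aR aB u /pol_feasible; apply: fg.
Qed.

Lemma cond_expect_total_arr_blue d n :
  E d n (fun h => (total arr_blue h)%:R) = n%:R * lambdaB.
Proof.
elim: n => [|n IH]; first by rewrite /= /total big_nil mul0r.
rewrite (@cond_expect_arrivals _ _ _ (fun h _ aB => (total arr_blue h)%:R + aB%:R)); last first.
  by move=> h aR aB u _ _ _; rewrite total_rcons natrD.
transitivity (E d n (fun h => (total arr_blue h)%:R + lambdaB)); last first.
  by rewrite (finitaryD (finitary_conserving d n)) IH cond_expect_cst -natr1 mulrDl mul1r.
apply: (finitary_eq (finitary_conserving d n)) => h _.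
by rewrite mean_arrivalsE /=; ring.
Qed.

(** Consistency in time: forgetting the last of [n.+1] slots gives the law of [n] slots. It lets
    quantities at times [n] and [n.+1] be compared under one expectation. *)
Lemma cond_expect_behead d n f :
  E d n.+1 (fun h => f (take (size h).-1 h)) = E d n f.
Proof.
rewrite (@cond_expect_arrivals _ _ _ (fun h _ _ => f h)).
  by apply: (finitary_eq (finitary_conserving d n)) => h _; rewrite mean_arrivalsE; ring.
by move=> h aR aB u _ _ _; rewrite size_rcons -cats1 take_size_cat.
Qed.

End Dynamics.

(** * Lower bound on the queues of an anonymous policy *)

Section LowerBound.
Context {R : realType}.
Variables (lambdaR lambdaB : R) (pol : policy (R := R)).
Hypotheses (lR01 : 0 <= lambdaR <= 1) (lB01 : 0 <= lambdaB <= 1).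
Hypothesis polP : is_policy pol.

Variable d : bool.

Local Notation E1 n := (cond_expect lambdaR lambdaB pol d n).
Local Notation E0 n := (cond_expect lambdaR lambdaB pol (~~ d) n).
Local Notation view1 h := (map (view d) h).
Local Notation view0 h := (map (view (~~ d)) h).
Local Notation prev h := (take (size h).-1 h).

Hypothesis same_view : forall n v,
  E1 n (fun h => (view1 h == v)%:R) = E0 n (fun h => (view0 h == v)%:R).

Let fin1 n := finitary_conserving lR01 lB01 polP d n.
Let fin0 n := finitary_conserving lR01 lB01 polP (~~ d) n.

Local Notation K n :=
  (coupling (E1 n) (E0 n) (fun h => view1 h) (fun h => view0 h)).
Local Notation C n := (cnd (E0 n) (fun h => view0 h)).

(** The view shows the arrivals, and the output link that carries red under [d] carries blue under
    [~~ d]. *)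
Lemma same_view_total h1 h0 : view1 h1 = view0 h0 ->
  total arr_blue h1 = total arr_blue h0 /\ total sentR h1 = total sentB h0.
Proof.
move=> v10; split.
  have tE b h : total arr_blue h = (\sum_(x <- map (view b) h) x.1.1.2)%N by rewrite /total big_map.
  by rewrite (tE d) v10 -tE.
have -> : total sentR h1 = (\sum_(x <- view1 h1) if d then x.1.2 else x.2)%N.
  by rewrite /total big_map; apply: eq_bigr => s _; rewrite /view /=; case: (d).
rewrite v10 /total big_map; apply: eq_bigr => s _; rewrite /view /=.
by case: (d).
Qed.

Lemma total_prev f h : (total f (prev h) <= total f h)%N.
Proof. by rewrite -[X in (_ <= total f X)%N](cat_take_drop (size h).-1) /total big_cat leq_addr. Qed.

Lemma expect_view n g : E1 n (fun h => g (view1 h)) = E0 n (fun h => g (view0 h)).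
Proof.
rewrite -(coupling_l (fin1 n) (fin0 n) (same_view n)).
rewrite -[RHS](coupling_r (fin1 n) (fin0 n) (same_view n)).
by apply: (coupling_eq (fin1 n) (fin0 n) (same_view n)) => h1 h0 _ _ ->.
Qed.

Definition imbalance (h : history) : int := (total arr_red h)%:Z - (total arr_blue h)%:Z.

(* x - y, for the red queue x of h1 and the blue queue y of h0, since both have
   sent as many packets. *)
Definition net (h1 h0 : history) : int :=
  imbalance h1 - (total dropR h1)%:Z + (total dropB h0)%:Z.

(** Equal views make the packets sent cancel in [x - y], and [|x - y| <= x + y]; the two marginals
    of the coupling do the rest. *)
Lemma coupling_net n :
  K n (fun h1 h0 => `|net h1 h0|%:~R) <=
  E1 n (fun h => (red_queue h)%:R) + E0 n (fun h => (blue_queue h)%:R).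
Proof.
rewrite -(coupling_l (fin1 n) (fin0 n) (same_view n)).
rewrite -(coupling_r (fin1 n) (fin0 n) (same_view n)).
rewrite -(couplingD (fin1 n) (fin0 n) (same_view n)).
apply: (coupling_le (fin1 n) (fin0 n) (same_view n)) => h1 h0 [[cR1 cB1] _] [[cR0 cB0] _] /same_view_total.
case=> eB eS; rewrite -natrD -[leRHS]/((_%:Z)%:~R) ler_int.
rewrite /net /imbalance red_queueE blue_queueE; lia.
Qed.

(** Conditional tails of the number of blue drops in the first [n] slots: [T] conditions on the view
    of these slots, [T'] also on the view of the next one. From [T] to [T'] is a martingale step. *)
Let T n j := C n (fun h => (j <= total dropB h)%:R).
Let T' n j := C n.+1 (fun h => (j <= total dropB (prev h))%:R).

Lemma view_prev b h : map (view b) (prev h) = prev (map (view b) h).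
Proof. by rewrite map_take size_map. Qed.

(** Martingale increments are orthogonal, so the left side is the increase of the second moment from
    [T] to [T']; and [T'] is at most [T n.+1] because drops only accumulate. *)
Lemma variance_step n j :
  E0 n.+1 (fun h => (T' n j (view0 h) - T n j (view0 (prev h))) ^+ 2) <=
  E0 n.+1 (fun h => T n.+1 j (view0 h) ^+ 2) - E0 n (fun h => T n j (view0 h) ^+ 2).
Proof.
(* By the tower property both sides are the expectation of the indicator of at least [j] drops in
   [n] slots times [T] at the view of these slots. *)
have cross : E0 n.+1 (fun h => T' n j (view0 h) * T n j (view0 (prev h))) =
    E0 n (fun h => T n j (view0 h) ^+ 2).
  rewrite (finitary_eq (fin0 n.+1) (g := fun h => T' n j (view0 h) * T n j (prev (view0 h)))); last first.
    by move=> h _; rewrite view_prev.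
  rewrite (tower _ _ (fun v : seq (bool * bool * bool * bool) => T n j (prev v)) (fin0 n.+1)).
  rewrite (finitary_eq (fin0 n) (f := fun h => T n j (view0 h) ^+ 2) (fun h _ => expr2 _)).
  rewrite [RHS](tower _ _ (T n j) (fin0 n)).
  rewrite -[RHS](cond_expect_behead lR01 lB01 polP).
  by apply: (finitary_eq (fin0 n.+1)) => h _; rewrite view_prev.
have T'0 h : 0 <= T' n j (view0 h) <= T n.+1 j (view0 h).
  rewrite (cnd_le (fin0 n.+1)) => [|h' _ _]; last first.
    rewrite ler_nat; case: (leqP j (total dropB (prev h'))) => // jp.
    by rewrite (leq_trans jp) ?total_prev.
  rewrite andbT /T' -[leLHS](mul0r (C n.+1 (fun=> 0) (view0 h))).
  rewrite -(cndZ (F1 := E0 n.+1) (v1 := fun h => view0 h) (fin0 n.+1)) //.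
  by apply: (cnd_le (fin0 n.+1)) => h' _ _; rewrite mul0r.
have -> : E0 n.+1 (fun h => (T' n j (view0 h) - T n j (view0 (prev h))) ^+ 2) =
  E0 n.+1 (fun h => T' n j (view0 h) ^+ 2) - 2 * E0 n (fun h => T n j (view0 h) ^+ 2)
  + E0 n.+1 (fun h => T n j (view0 (prev h)) ^+ 2).
  rewrite -cross -(finitaryZ (fin0 n.+1)) -(finitaryB (fin0 n.+1)) -(finitaryD (fin0 n.+1)).
  by apply: (finitary_eq (fin0 n.+1)) => h _; ring.
rewrite (cond_expect_behead lR01 lB01 polP (~~ d) n (fun h => T n j (view0 h) ^+ 2)).
have : E0 n.+1 (fun h => T' n j (view0 h) ^+ 2) <= E0 n.+1 (fun h => T n.+1 j (view0 h) ^+ 2).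
  apply: (finitary_le (fin0 n.+1)) => h _; have /andP[T0 TT] := T'0 h.
  by rewrite ler_sqr ?nnegrE // (le_trans T0).
lra.
Qed.

Lemma tail_ge0_le1 n j v : 0 <= T n j v <= 1.
Proof.
(* Only an inequality, since the conditional mass is 0 at a view of probability zero. *)
have C1 : C n (fun=> 1) v <= 1.
  rewrite /cnd (finitary_eq (fin0 n) (g := fun h => (view0 h == v)%:R)); last first.
    by move=> h _; rewrite mulr1.
  by have [->|x0] := eqVneq (E0 n (fun h => (view0 h == v)%:R)) 0; rewrite ?mul0r // mulfV.
rewrite (le_trans _ C1) ?andbT; last first.
  by apply: (cnd_le (fin0 n)) => h _ _; rewrite lern1 leq_b1.
rewrite -[leLHS](mul0r (C n (fun=> 0) v)).
rewrite -(cndZ (F1 := E0 n) (v1 := fun h => view0 h) (fin0 n)) //.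
by apply: (cnd_le (fin0 n)) => h' _ _; rewrite mul0r.
Qed.

(** A tail lies in [0, 1], so its square is at most itself, and the tails of [D] add up to at most
    [1 + D]; the 1 comes from [j = 0]. *)
Lemma tail_square_sum M N :
  \sum_(j < M) E0 N (fun h => T N j (view0 h) ^+ 2) <= 1 + E0 N (fun h => (total dropB h)%:R).
Proof.
apply: (@le_trans _ _ (\sum_(j < M) E0 N (fun h => (j <= total dropB h)%:R * 1))).
  apply: ler_sum => j _; rewrite -(tower (fun h => view0 h) _ (fun=> 1) (fin0 N)).
  apply: (finitary_le (fin0 N)) => h _; have /andP[? ?] := tail_ge0_le1 N j (view0 h).
  by rewrite expr2 ler_wpM2l.
rewrite -(finitary_bigsum (fin0 N)) -[X in _ <= X + _](cond_expect_cst lR01 lB01 polP (~~ d) N).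
rewrite -(finitaryD (fin0 N)); apply: (finitary_le (fin0 N)) => h _.
rewrite nat1r; under eq_bigr do rewrite mulr1.
rewrite -natr_sum ler_nat; elim: M => [|n IH]; first by rewrite big_ord0.
rewrite big_ord_recr /=; case: (leqP n (total dropB h)) => [nD|_]; last by rewrite addn0.
apply: (@leq_trans (n + 1)); last by rewrite addn1.
rewrite leq_add2r -[leqRHS]card_ord -sum1_card.
by apply: leq_sum => i _; exact: leq_b1.
Qed.

(** * Drift of a potential along the coupling *)

Variables (L : nat) (sigma : nat -> R) (m : int) (q : R).
Hypothesis sigma_ge0 : forall i, 0 <= sigma i.

(** A nondecreasing step function given by its slopes: [sigma i] is the increment from [m - i] to
    [m - i + 1]. Indexing downwards from [m] suits slopes that vanish above the threshold. *)
Definition potential (z : int) : R := \sum_(i < L) sigma i * (m - i%:Z < z)%R%:R.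

Hypothesis bellman : forall z : int,
  q + mean_arrivals lambdaR lambdaB (fun aR aB => potential (z + aR%:Z - aB%:Z))
  <= `|z|%:~R + potential z.

Let S1 := \sum_(i < L) sigma i.
Let S2 := \sum_(i < L) sigma i ^+ 2.

Lemma potential_ge0 z : 0 <= potential z.
Proof. by apply: sumr_ge0 => i _; rewrite mulr_ge0. Qed.

Lemma potential_le z : potential z <= S1.
Proof. by apply: ler_sum => i _; rewrite ler_piMr ?lern1 ?leq_b1. Qed.

Lemma potential_mono z z' : z <= z' -> potential z <= potential z'.
Proof.
move=> zz; apply: ler_sum => i _; rewrite ler_wpM2l // ler_nat.
by case: (ltP (m - i%:Z) z) => // /lt_le_trans ->.
Qed.

(** The total rise [S1] bounds any positive shift; the factor [k] makes it a price per blue drop. *)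
Lemma potential_shift z (k : nat) : potential (z + k%:Z) <= potential z + S1 * k%:R.
Proof.
case: k => [|k]; first by rewrite mulr0 !addr0.
have S10 : 0 <= S1 by apply: sumr_ge0.
apply: (le_trans (potential_le _)); apply: ler_wpDl; first exact: potential_ge0.
by rewrite ler_peMr // ler1n.
Qed.

Let mid h1 h0 : int :=
  imbalance h1 - (total dropR (prev h1))%:Z + (total dropB (prev h0))%:Z.

(** [mid] counts the last arrivals but not the last drops. Red drops only lower the argument of a
    nondecreasing function, and each blue drop costs at most [S1]. *)
Lemma drop_step n :
  K n.+1 (fun h1 h0 => potential (net h1 h0)) <=
  K n.+1 (fun h1 h0 => potential (mid h1 h0))
  + S1 * (E0 n.+1 (fun h => (total dropB h)%:R) - E0 n (fun h => (total dropB h)%:R)).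
Proof.
rewrite -(cond_expect_behead lR01 lB01 polP (~~ d) n).
rewrite -(finitaryB (fin0 n.+1)) -(finitaryZ (fin0 n.+1)).
rewrite -(coupling_r (fin1 n.+1) (fin0 n.+1) (same_view n.+1)).
rewrite -(couplingD (fin1 n.+1) (fin0 n.+1) (same_view n.+1)).
apply: (coupling_le (fin1 n.+1) (fin0 n.+1) (same_view n.+1)) => h1 h0 _ _ _.
have := total_prev dropB h0; have := total_prev dropR h1; move=> dR dB.
rewrite -natrB //; apply: (le_trans _ (potential_shift _ _)).
by apply: potential_mono; rewrite /net /mid; lia.
Qed.

(** Here [h0] keeps its conditional law given the first [n] views. The new arrivals are independent
    of the pair, so the Bellman inequality applies pointwise. *)
Lemma ideal_step n :
  E1 n.+1 (fun h1 => C n (fun h0 =>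
     potential (imbalance h1 - (total dropR (prev h1))%:Z + (total dropB h0)%:Z))
     (view1 (prev h1))) <=
  K n (fun h1 h0 => potential (net h1 h0)) - q + K n (fun h1 h0 => `|net h1 h0|%:~R).
Proof.
have q_K : q = K n (fun _ _ => q).
  by rewrite (coupling_l (fin1 n) (fin0 n) (same_view n)) (cond_expect_cst lR01 lB01 polP).
rewrite [in leRHS]q_K -(couplingB (fin1 n) (fin0 n) (same_view n)).
rewrite -(couplingD (fin1 n) (fin0 n) (same_view n)).
rewrite (@cond_expect_arrivals _ _ _ _ lR01 lB01 polP _ _ _ (fun h1 aR aB => C n (fun h0 =>
     potential (net h1 h0 + aR%:Z - aB%:Z)) (view1 h1))); last first.
  move=> h aR aB u _ _ _; rewrite size_rcons -cats1 take_size_cat //= cats1.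
  congr (cnd _ _ _ _); apply: funext => h0; congr potential.
  by rewrite /net /imbalance !total_rcons /arr_red /arr_blue /=; lia.
apply: (@le_trans _ _ (K n (fun h1 h0 => mean_arrivals lambdaR lambdaB
    (fun aR aB => potential (net h1 h0 + aR%:Z - aB%:Z))))).
  rewrite le_eqVlt; apply/orP; left; apply/eqP.
  apply: (finitary_eq (fin1 n)) => h1 _.
  rewrite /mean_arrivals (cnd_bigsum (fin0 n) (same_view n)); apply: eq_bigr => aR _.
  rewrite (cnd_bigsum (fin0 n) (same_view n)); apply: eq_bigr => aB _.
  by rewrite (cndZ (fin0 n) (same_view n)).
apply: (coupling_le (fin1 n) (fin0 n) (same_view n)) => h1 h0 _ _ _.
by rewrite addrAC lerBrDl [leRHS]addrC; exact: bellman.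
Qed.

Let tail_index (i z : int) : nat := if i < z then 0%N else `|i - z|.+1.

Lemma tail_indexP i z (D : nat) : (i < z + D%:Z) = (tail_index i z <= D)%N.
Proof. by rewrite /tail_index; case: (ltP i z) => ?; lia. Qed.

(** Layer-cake form: a change of the conditional law affects the mean potential only through [L]
    tails of the drops. *)
Lemma potential_tail n (f : history -> nat) z v :
  C n (fun h0 => potential (z + (f h0)%:Z)) v =
  \sum_(i < L) sigma i * C n (fun h0 => (tail_index (m - i%:Z) z <= f h0)%:R) v.
Proof.
rewrite (cnd_bigsum (fin0 n) (same_view n)); apply: eq_bigr => i _.
rewrite (cndZ (fin0 n) (same_view n)); congr (_ * cnd _ _ _ _).
by apply: funext => h0; rewrite tail_indexP.
Qed.

Lemma dropB_le_size h : conserving h -> (total dropB h <= size h)%N.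
Proof. by case=> _ hB; have := total_le_size arr_blue h; lia. Qed.

Lemma cnd_tail0 n (f : history -> nat) (j : nat) v :
  (forall h, conserving h -> size h = n -> f h < j)%N -> C n (fun h => (j <= f h)%:R) v = 0.
Proof.
move=> fj; rewrite -[RHS](mul0r (C n (fun=> 0) v)) -(cndZ (fin0 n) (same_view n)).
rewrite /cnd; congr (_ / _); apply: (finitary_eq (fin0 n)) => h [hc hn].
by rewrite leqNgt fj // mul0r.
Qed.

(** The difference is a sum of [sigma i * x], with [x] the increment of one tail. Each product is at
    most [eps * sigma i ^+ 2 + x ^+ 2 / (4 * eps)], and every [x ^+ 2] is bounded by the sum over
    all [j], whence the factor [L]. *)
Lemma information_step N n (eps : R) : (n.+1 < N)%N -> 0 < eps ->
  K n.+1 (fun h1 h0 => potential (mid h1 h0)) -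
  E1 n.+1 (fun h1 => C n (fun h0 =>
     potential (imbalance h1 - (total dropR (prev h1))%:Z + (total dropB h0)%:Z))
     (view1 (prev h1))) <=
  eps * S2 + L%:R / (4 * eps) * \sum_(j < N)
    E0 n.+1 (fun h => (T' n j (view0 h) - T n j (view0 (prev h))) ^+ 2).
Proof.
move=> nN eps0.
pose err v := \sum_(j < N) (T' n j v - T n j (prev v)) ^+ 2.
have -> : \sum_(j < N) E0 n.+1 (fun h => (T' n j (view0 h) - T n j (view0 (prev h))) ^+ 2)
    = E1 n.+1 (fun h => err (view1 h)).
  rewrite expect_view /err (finitary_bigsum (fin0 n.+1)).
  by apply: eq_bigr => j _; apply: (finitary_eq (fin0 n.+1)) => h _; rewrite view_prev.
rewrite -(finitaryB (fin1 n.+1)) -(finitaryZ (fin1 n.+1)).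
rewrite -[eps * S2](cond_expect_cst lR01 lB01 polP d n.+1) -(finitaryD (fin1 n.+1)).
apply: (finitary_le (fin1 n.+1)) => h1 _.
rewrite !potential_tail -sumrB.
set z := imbalance h1 - _.
have -> : eps * S2 + L%:R / (4 * eps) * err (view1 h1) =
    \sum_(i < L) (eps * sigma i ^+ 2 + (4 * eps)^-1 * err (view1 h1)).
  rewrite big_split /= -!big_distrr /= sumr_const card_ord -[err _ *+ _]mulr_natl.
  by rewrite mulrA [_^-1 * _]mulrC.
apply: ler_sum => i _; rewrite -mulrBr.
set j := tail_index _ z.
set x := (X in _ * X <= _).
have x_err : x ^+ 2 <= err (view1 h1).
  have err0 : 0 <= err (view1 h1) by apply: sumr_ge0 => k _; exact: sqr_ge0.
  (* Beyond [N] both tails vanish: there is at most one blue drop per slot on average, so fewer than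
     [N] in all. *)
  have [jN|jN] := ltnP j N; last first.
    rewrite /x !cnd_tail0 ?subr0 ?expr0n //= => h hc hn.
      by have := dropB_le_size hc; have := total_prev dropB h; lia.
    by have := dropB_le_size hc; have := total_prev dropB h; lia.
  rewrite /x view_prev /err (bigD1 (Ordinal jN)) //= ler_wpDr //.
  by apply: sumr_ge0 => k _; exact: sqr_ge0.
apply: (@le_trans _ _ (eps * sigma i ^+ 2 + (4 * eps)^-1 * x ^+ 2)); last first.
  by rewrite lerD2l ler_wpM2l // invr_ge0; lra.
have : 0 <= (eps * sigma i - x / 2) ^+ 2 / eps by rewrite divr_ge0 ?sqr_ge0 ?ltW.
suff -> : (eps * sigma i - x / 2) ^+ 2 / eps =
   eps * sigma i ^+ 2 - sigma i * x + (4 * eps)^-1 * x ^+ 2 by lra.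
by field; rewrite gt_eqF.
Qed.

(** The three steps are summed over time. [Q], the sum of the second moments of the tails, grows at
    least as fast as the information cost and is at most [1 + E D] at time [N]. *)
Lemma queue_sum_ge N (eps : R) : 0 < eps ->
  N%:R * q <=
  \sum_(n < N) (E1 n (fun h => (red_queue h)%:R) + E0 n (fun h => (blue_queue h)%:R))
  + (S1 + S1 * E0 N (fun h => (total dropB h)%:R)) + N%:R * (eps * S2)
  + L%:R / (4 * eps) * (1 + E0 N (fun h => (total dropB h)%:R)).
Proof.
move=> eps0; set c := L%:R / (4 * eps).
have c0 : 0 <= c by rewrite divr_ge0 // mulr_ge0 // ltW.
have S10 : 0 <= S1 by apply: sumr_ge0.
pose D n := E0 n (fun h => (total dropB h)%:R).
pose Q n := \sum_(j < N.+1) E0 n (fun h => T n j (view0 h) ^+ 2).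
pose Phi n := K n (fun h1 h0 => potential (net h1 h0)).
pose cost n := E1 n (fun h => (red_queue h)%:R) + E0 n (fun h => (blue_queue h)%:R).
have Phi_ge0 n : 0 <= Phi n.
  rewrite -[leLHS](cond_expect_cst lR01 lB01 polP d n).
  rewrite -(coupling_l (fin1 n) (fin0 n) (same_view n)).
  apply: (coupling_le (fin1 n) (fin0 n) (same_view n)) => *; exact: potential_ge0.
suff H n : (n <= N)%N -> n%:R * q + Phi n <=
    \sum_(k < n) cost k + (S1 + S1 * D n) + n%:R * (eps * S2) + c * Q n.
  apply: (@le_trans _ _ (N%:R * q + Phi N)); first by rewrite lerDl.
  by apply: (le_trans (H N (leqnn N))); rewrite lerD2l ler_wpM2l // tail_square_sum.
elim: n => [_|n IH nN].
  rewrite !mul0r big_ord0 !add0r addr0 -addrA ler_wpDr //.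
    have D0 : 0 <= D 0%N by exact: ler0n.
    have Q0 : 0 <= Q 0%N by apply: sumr_ge0 => j _; rewrite /= sqr_ge0.
    by rewrite addr_ge0 // mulr_ge0.
  rewrite -[leRHS](cond_expect_cst lR01 lB01 polP d 0).
  rewrite -(coupling_l (fin1 0%N) (fin0 0%N) (same_view 0%N)).
  apply: (coupling_le (fin1 0%N) (fin0 0%N) (same_view 0%N)) => *; exact: potential_le.
have Qstep : c * (\sum_(j < N.+1)
    E0 n.+1 (fun h => (T' n j (view0 h) - T n j (view0 (prev h))) ^+ 2)) <= c * Q n.+1 - c * Q n.
  rewrite -mulrBr ler_wpM2l // -sumrB; apply: ler_sum => j _; exact: variance_step.
have -> : \sum_(k < n.+1) cost k = \sum_(k < n) cost k + cost n by rewrite big_ord_recr.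
rewrite -natr1 !mulrDl !mul1r.
have := IH (ltnW nN); have := drop_step n; have := ideal_step n.
have := @information_step N.+1 n eps nN eps0; rewrite -/c.
have := coupling_net n; rewrite -/(cost n) -/(Phi n) -/(Phi n.+1) -/(D n) -/(D n.+1).
lra.
Qed.

End LowerBound.

(** * Anonymity equalizes the laws of the views *)

Section Anonymity.
Context {R : realType}.

Lemma ln_le_sub1 (x : R) : 0 < x -> ln x <= x - 1.
Proof. by move=> x0; rewrite -{1}(subrK 1 x) addrC le_ln1Dx //; lra. Qed.

(** Applying [ln y <= y - 1] to the inverse of [1 + x] gives [ln (1 + x) >= x / (1 + x)], which
    dominates the quadratic when [x >= -1/2]. *)
Lemma ln_ge_quadratic (x : R) : `|x| <= 2^-1 -> x - 2 * x ^+ 2 <= ln (1 + x).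
Proof.
rewrite ler_norml => /andP[x1 x2].
have x0 : 0 < 1 + x by lra.
have : - ln (1 + x) <= (1 + x)^-1 - 1.
  by rewrite -lnV ?posrE // ln_le_sub1 // invr_gt0.
have : x * (1 - 2 * x) <= 1 - (1 + x)^-1.
  have -> : 1 - (1 + x)^-1 = x / (1 + x) by field; rewrite gt_eqF.
  rewrite ler_pdivlMr //.
  have : 0 <= x ^+ 2 * (1 + 2 * x) by rewrite mulr_ge0 ?sqr_ge0 //; lra.
  by move=> ?; nra.
by rewrite expr2; lra.
Qed.

(* Gibbs' inequality against the reference weight theta. *)
Lemma entropy_term_le (a s theta : R) : 0 <= a <= s -> 0 < theta ->
  - (a * log2 (a / s)) * ln 2 <= a * ln 2 + s * theta / 2 - a - a * ln theta.
Proof.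
move=> /andP[a0 as_] t0; have ln20 : ln 2 != 0 :> R by rewrite gt_eqF // ln_gt0 // ltr1n.
have [->|aN0] := eqVneq a 0.
  by rewrite !mul0r oppr0 mul0r !addr0 add0r divr_ge0 ?mulr_ge0 ?(le_trans a0 as_) // ltW.
have {}a0 : 0 < a by rewrite lt0r aN0.
have s0 : 0 < s by exact: lt_le_trans as_.
have -> : - (a * log2 (a / s)) * ln 2 = - (a * ln (a / s)) by rewrite /log2; field.
have x0 : 0 < s * theta / (2 * a) by rewrite divr_gt0 ?mulr_gt0.
have := ln_le_sub1 x0; rewrite !ln_div ?posrE ?mulr_gt0 // !lnM ?posrE // => H.
have : a * (ln s + ln theta - (ln 2 + ln a)) <= a * (s * theta / (2 * a) - 1).
  by rewrite ler_wpM2l // ltW.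
have -> : a * (s * theta / (2 * a) - 1) = s * theta / 2 - a by field.
by lra.
Qed.

(** Gibbs' inequality with reference weights [(1 + tau) / 2] for the larger of [a], [b] and
    [(1 - tau) / 2] for the smaller, the logarithms being expanded to second order. *)
Lemma entropy_pair_le (a b tau : R) : 0 <= a -> 0 <= b -> 0 <= tau <= 2^-1 ->
  (- (a * log2 (a / (a + b))) - b * log2 (b / (a + b))) * ln 2 <=
  (a + b) * ln 2 - (tau * `|a - b| - 2 * tau ^+ 2 * (a + b)).
Proof.
wlog ba : a b / b <= a => [H a0 b0 t0|].
  have [ba|/ltW ab] := leP b a; first exact: H.
  have := H _ _ ab b0 a0 t0; rewrite distrC [b + a]addrC; lra.
move=> a0 b0 /andP[t0 t1].
have ab0 : 0 <= a <= a + b by rewrite a0 lerDl.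
have ba0 : 0 <= b <= a + b by rewrite b0 lerDr.
have := @entropy_term_le a (a + b) (1 + tau) ab0.
have := @entropy_term_le b (a + b) (1 - tau) ba0.
have -> : 0 < 1 - tau by lra.
have -> : 0 < 1 + tau by lra.
move=> /(_ isT) H1 /(_ isT) H2.
have : b * (- tau - 2 * (- tau) ^+ 2) <= b * ln (1 + - tau).
  by rewrite ler_wpM2l // ln_ge_quadratic // normrN ger0_norm.
have : a * (tau - 2 * tau ^+ 2) <= a * ln (1 + tau).
  by rewrite ler_wpM2l // ln_ge_quadratic // ger0_norm.
rewrite (ger0_norm (_ : 0 <= a - b)) ?subr_ge0 // sqrrN; nra.
Qed.

Lemma cond_entropy_le (Y : finType) (p : bool -> Y -> R) (tau : R) :
  (forall x y, 0 <= p x y) -> \sum_x \sum_y p x y = 1 -> 0 <= tau <= 2^-1 ->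
  cond_entropy p * ln 2 <=
  ln 2 - (tau * (\sum_y `|p true y - p false y|) - 2 * tau ^+ 2).
Proof.
move=> p0 p1 tau01; rewrite /cond_entropy.
have sE y : \sum_(x' : bool) p x' y = p true y + p false y by rewrite big_bool.
have s1 : \sum_y (p true y + p false y) = 1.
  by rewrite -p1 big_bool /= -big_split.
rewrite big_bool /= -big_split /= -sumrN big_distrl /=.
have -> : ln 2 - (tau * (\sum_y `|p true y - p false y|) - 2 * tau ^+ 2) =
  \sum_y ((p true y + p false y) * ln 2 - (tau * `|p true y - p false y|
     - 2 * tau ^+ 2 * (p true y + p false y))).
  by rewrite !(big_split, sumrN) /= -!big_distrr -!big_distrl /= s1 mul1r mulr1.
apply: ler_sum => y _; rewrite sE opprD; exact: entropy_pair_le.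
Qed.

(** * From the entropy limit to equal laws of the views *)

Variables (lambdaR lambdaB : R) (pol : policy (R := R)).
Hypotheses (lR01 : 0 <= lambdaR <= 1) (lB01 : 0 <= lambdaB <= 1).
Hypothesis polP : is_policy pol.

Local Notation E d n := (cond_expect lambdaR lambdaB pol d n).
Let fin d n := finitary_conserving lR01 lB01 polP d n.

Lemma cond_expect_take d n k f :
  E d (n + k) (fun h => f (take n h)) = E d n f.
Proof.
elim: k => [|k IH].
  rewrite addn0; apply: (finitary_eq (fin d n)) => h [_ <-].
  by rewrite take_size.
rewrite addnS -IH -[RHS](cond_expect_behead lR01 lB01 polP).
apply: (finitary_eq (fin d (n + k).+1)) => h [_ hn].
by rewrite take_takel // hn /= leq_addr.
Qed.

Lemma sum_tuples (T : finType) n (w : seq T) (g : n.-tuple T -> R) :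
  \sum_(y : n.-tuple T) (w == y :> seq T)%:R * g y =
  if insub w is Some y then g y else 0.
Proof.
case: insubP => [y _ wy|nw].
  rewrite (bigD1 y) //= -wy eqxx mul1r big1 ?addr0 // => z zy.
  by rewrite (_ : (_ == _) = false) ?mul0r //; apply/negbTE; rewrite eq_sym; move: zy; rewrite -val_eqE.
rewrite big1 // => y _; have [wy|] := eqVneq w y; last by rewrite mul0r.
by move: nw; rewrite wy size_tuple eqxx.
Qed.

Lemma sum_joint_pmf n d (g : seq (bool * bool * bool * bool) -> R) :
  \sum_(y : n.-tuple (bool * bool * bool * bool)) joint_pmf lambdaR lambdaB pol d y * g y =
  2^-1 * E d n (fun h => g (map (view d) h)).
Proof.
under eq_bigr do rewrite /joint_pmf -mulrA -(finitaryZr (fin d n)).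
rewrite -big_distrr -(finitary_bigsum (fin d n)); congr (_ * _).
apply: (finitary_eq (fin d n)) => h [_ hn].
rewrite (sum_tuples _ (fun y : n.-tuple _ => g (tval y))).
case: insubP => [y _ -> //|]; by rewrite size_map hn eqxx.
Qed.

Lemma joint_pmf_ge0 n d (y : n.-tuple (bool * bool * bool * bool)) :
  0 <= joint_pmf lambdaR lambdaB pol d y.
Proof.
rewrite mulr_ge0 ?invr_ge0 // -(mul0r (E d n (fun=> 1))) -(finitaryZ (fin d n)).
by apply: (finitary_le (fin d n)) => h _; rewrite mul0r.
Qed.

Lemma joint_pmf_total n :
  \sum_x \sum_(y : n.-tuple _) joint_pmf lambdaR lambdaB pol x y = 1.
Proof.
have pd d : \sum_(y : n.-tuple _) joint_pmf lambdaR lambdaB pol d y = 2^-1.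
  under eq_bigr do rewrite -[joint_pmf _ _ _ _ _]mulr1.
  by rewrite (sum_joint_pmf _ d (fun=> 1)) (cond_expect_cst lR01 lB01 polP) mulr1.
by rewrite big_bool /= !pd; lra.
Qed.

(** A discrepancy [delta] at a view [v] of [n] slots persists at every later time, as it is seen on
    the first [n] slots. The entropy then stays below 1 by a fixed amount. *)
Lemma same_view_of_anonymity : perfect_anonymity lambdaR lambdaB pol ->
  forall d n v, E d n (fun h => (map (view d) h == v)%:R) =
                E (~~ d) n (fun h => (map (view (~~ d)) h == v)%:R).
Proof.
move=> anon.
suff H n v : E true n (fun h => (map (view true) h == v)%:R) =
             E false n (fun h => (map (view false) h == v)%:R).
  by case=> n v; rewrite H.
apply/eqP; rewrite -subr_eq0 -normr_eq0; apply/negPn/negP.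
set delta := `|_| => deltaN0.
have delta0 : 0 < delta by rewrite lt0r deltaN0 normr_ge0.
have size_v : size v = n.
  apply/eqP; apply: contraNT deltaN0 => sv; rewrite normr_eq0 subr_eq0; apply/eqP.
  transitivity (0 * E true n (fun=> 1)); last rewrite mul0r -[LHS](mul0r (E false n (fun=> 1))).
    rewrite -(finitaryZ (fin true n)); apply: (finitary_eq (fin true n)) => h [_ hn].
    by rewrite mul0r; case: eqVneq => // hv; move: sv; rewrite -hv size_map hn eqxx.
  rewrite -(finitaryZ (fin false n)); apply: (finitary_eq (fin false n)) => h [_ hn].
  by rewrite mul0r; case: eqVneq => // hv; move: sv; rewrite -hv size_map hn eqxx.
pose p k : bool -> (n + k).-tuple _ -> R := @joint_pmf R lambdaR lambdaB pol (n + k).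
have p_dist k : 2^-1 * delta <= \sum_y `|p k true y - p k false y|.
  have E_v d : \sum_(y : (n + k).-tuple _) p k d y * (take n y == v)%:R =
      2^-1 * E d n (fun h => (map (view d) h == v)%:R).
    rewrite (sum_joint_pmf _ d (fun y => (take n y == v)%:R)); congr (_ * _).
    rewrite -(cond_expect_take d n k); apply: (finitary_eq (fin d (n + k))) => h _.
    by rewrite map_take.
  rewrite /delta -[X in X * _]ger0_norm ?invr_ge0 // -normrM mulrBr -!E_v -sumrB.
  apply: (le_trans (ler_norm_sum _ _ _)); apply: ler_sum => y _.
  by rewrite -mulrBl normrM ler_piMr // normr_nat lern1 leq_b1.
have p_one k := joint_pmf_total (n + k).
have p_ge0 k x y : 0 <= p k x y by exact: joint_pmf_ge0.
have delta1 : delta <= 2.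
  have := p_dist 0%N; have : \sum_y `|p 0%N true y - p 0%N false y| <= \sum_y (p 0%N true y + p 0%N false y).
    apply: ler_sum => y _; rewrite ler_norml; apply/andP.
    by have := p_ge0 0%N true y; have := p_ge0 0%N false y; split; lra.
  by have := p_one 0%N; rewrite big_bool /= -big_split /=; lra.
(* The maximizer of [tau * (delta / 2) - 2 * tau ^+ 2], whose maximum [delta ^+ 2 / 32] gives [eta];
   [delta <= 2] ensures [tau <= 1/2]. *)
pose tau := delta / 8.
have tau01 : 0 <= tau <= 2^-1 by rewrite /tau; apply/andP; split; lra.
have ln20 : 0 < ln 2 :> R by rewrite ln_gt0 // ltr1n.
pose eta := delta ^+ 2 / 32 / ln 2.
have eta0 : 0 < eta by rewrite !divr_gt0 ?exprn_gt0.
have ent k : cond_entropy (p k) <= 1 - eta.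
  rewrite -(ler_pM2r ln20).
  apply: (le_trans (cond_entropy_le (p_ge0 k) (p_one k) tau01)).
  rewrite mulrBl mul1r /eta divfK ?gt_eqF // lerD2l lerN2.
  have : tau * (2^-1 * delta) <= tau * \sum_y `|p k true y - p k false y|.
    by rewrite ler_wpM2l //; case/andP: tau01.
  rewrite /tau expr2 expr2; lra.
have /cvgrPdist_lt/(_ _ eta0) [M _ HM] := anon.
have := HM (n + M)%N (leq_addl _ _); have := ent M; rewrite /p => e1.
by rewrite /= ltr_norml => /andP[_]; lra.
Qed.

End Anonymity.

(** * Poisson equation of the threshold chain *)

Section Threshold.
Context {R : realType}.
Variable r : R.
Hypothesis r01 : 0 <= r < 1.

(** The logarithmic formula is used only through these two inequalities: for [r > 1/2],
    [r ^+ n <= 1/2] means [n >= t] with [t = - 1 / log2 r], and [m + 1] is the ceiling of [t]. *)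
Lemma optimal_thresholdP : exists m : nat,
  [/\ m%:Z = optimal_threshold r, r ^+ m.+1 <= 2^-1 &
      forall n, (0 < n <= m)%N -> 2^-1 <= r ^+ n].
Proof.
have [r0 r1] := andP r01; rewrite /optimal_threshold.
case: ltP => [r2|r2]; last by exists 0%N; split; rewrite ?expr1 //; case.
have ln20 : 0 < ln 2 :> R by rewrite ln_gt0 // ltr1n.
have {r0} rgt0 : 0 < r by lra.
have lnr0 : ln r < 0 by rewrite ln_lt0 // rgt0.
have t1 : - (1 / log2 r) = ln 2 / (- ln r).
  by rewrite /log2; field; rewrite (lt_eqF lnr0) (gt_eqF ln20).
have lnr2 : - ln r < ln 2.
  by rewrite -lnV ?posrE // ltr_ln ?posrE ?invr_gt0 // -[2]invrK ltf_pV2 ?posrE ?invr_gt0.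
rewrite t1; set t := ln 2 / _.
have t_gt1 : 1 < t by rewrite /t ltr_pdivlMr ?oppr_gt0 // mul1r.
have c1 : 1 < Num.ceil t by rewrite ceil_gt_int.
exists `|Num.ceil t - 1|%N; have mE : `|Num.ceil t - 1|%N%:Z = Num.ceil t - 1.
  by rewrite gez0_abs // subr_ge0 ltW.
move: mE; set m := `|_|%N => mE.
have powE n : (r ^+ n <= 2^-1) = (t <= n%:R).
  rewrite -ler_ln ?posrE ?exprn_gt0 ?invr_gt0 // lnXn // lnV ?posrE //.
  by rewrite /t ler_pdivrMr ?oppr_gt0 // -[ln r *+ n]mulr_natl mulrN lerNr.
split => //.
  rewrite powE; apply: (le_trans (ceil_ge _)).
  by rewrite -natr1 -[m%:R]/(m%:Z%:~R) mE -[1]/(1%:~R) -intrD subrK.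
move=> n /andP[_ nm]; rewrite leNgt; apply/negP => /ltW; rewrite powE.
apply/negP; rewrite -ltNge; apply: (le_lt_trans _ (ceilB1_lt t)).
by rewrite -mE -[n%:R]/(n%:Z%:~R) ler_int lez_nat.
Qed.

End Threshold.

Lemma distance_to_threshold (m : nat) (z : int) (i := absz (m%:Z - z)%R) : z <= m%:Z ->
  [/\ z - 1 <= m%:Z, absz (m%:Z - (z - 1))%R = i.+1, m%:Z - i%:Z = z,
      m%:Z - i.+1%:Z = z - 1 & i%:Z <= m%:Z + `|z|].
Proof. by rewrite /i => zm; split; lia. Qed.

Section RelativeValue.
Context {R : realType}.
Variables (p r : R) (m : nat).
Hypotheses (p0 : 0 < p) (r01 : 0 <= r < 1).
Hypothesis m_stop : r ^+ m.+1 <= 2^-1.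
Hypothesis m_continue : forall n, (0 < n <= m)%N -> 2^-1 <= r ^+ n.

Let r0 : 0 <= r. Proof. by case/andP: r01. Qed.
Let r1 : 0 < 1 - r. Proof. by rewrite subr_gt0; case/andP: r01. Qed.
Let r1N0 : 1 - r != 0. Proof. by rewrite gt_eqF. Qed.

(* |z| + 2 r^(max(z,0)+1) / (1 - r): up to an affine transformation, the slope
   at z of the solution of the Poisson equation of the chain of z = x - y. *)
Definition slope_shape (z : int) : R :=
  match z with
  | Posz n => n%:R + 2 * r ^+ n.+1 / (1 - r)
  | Negz n => n.+1%:R + 2 * r / (1 - r)
  end.

(** The average cost in the Poisson equation, determined by requiring the slope to vanish at [m]. *)
Definition optimal_queue : R := slope_shape m - r / (1 - r).

Definition slope (z : int) : R :=
  if z <= m%:Z then (slope_shape z - slope_shape m) / (p * (1 - r)) else 0.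

Lemma slope_shape_rec z : slope_shape z - r * slope_shape (z - 1) = (1 - r) * `|z|%:~R + r.
Proof.
case: z => [[|n]|n].
- by have -> : 0%:Z - 1 = Negz 0 by []; rewrite /= expr1 normr0 mulr0 add0r; field.
- have -> : n.+1%:Z - 1 = n%:Z by lia.
  have -> : `|n.+1%:Z|%:~R = n.+1%:R :> R by [].
  by rewrite /= -!natr1 [r ^+ n.+2]exprS; field.
- have -> : Negz n - 1 = Negz n.+1 by lia.
  have -> : `|Negz n|%:~R = n.+1%:R :> R by [].
  by rewrite /= -!natr1; field.
Qed.

(** From [n] to [n + 1] the shape decreases by [2 * r ^+ n.+1 - 1], nonnegative up to the threshold;
    on the negative side it exceeds its value at 0. *)
Lemma slope_shape_min z : z <= m%:Z -> slope_shape m <= slope_shape z.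
Proof.
have H k : (k <= m)%N -> slope_shape m <= slope_shape (m - k)%N.
  elim: k => [|k IH] km; first by rewrite subn0.
  apply: (le_trans (IH (ltnW km))); have -> : (m - k = (m - k.+1).+1)%N by lia.
  set n := (m - k.+1)%N; have := @m_continue n.+1; have -> : (0 < n.+1 <= m)%N by lia.
  move=> /(_ isT) rn; rewrite /= -natr1 [r ^+ n.+2]exprS -subr_ge0.
  have -> : n%:R + 2 * r ^+ n.+1 / (1 - r) - (n%:R + 1 + 2 * (r * r ^+ n.+1) / (1 - r))
     = 2 * r ^+ n.+1 - 1 by field.
  lra.
case: z => n nm; first by have := H (m - n)%N (leq_subr _ _); rewrite subKn.
apply: (le_trans (H m (leqnn _))); rewrite subnn /= add0r expr1.
by rewrite lerDr.
Qed.

Lemma slope_ge0 z : 0 <= slope z.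
Proof.
rewrite /slope; case: ifP => // zm.
by rewrite divr_ge0 ?subr_ge0 ?slope_shape_min // mulr_ge0 // ltW.
Qed.

Lemma slope_bellman_eq z : z <= m%:Z ->
  optimal_queue = `|z|%:~R - p * slope z + r * p * slope (z - 1).
Proof.
move=> zm; rewrite /slope zm; have -> : z - 1 <= m%:Z by lia.
have := slope_shape_rec z; rewrite /optimal_queue => e.
have -> : slope_shape z = r * slope_shape (z - 1) + (1 - r) * `|z|%:~R + r by lra.
by field; rewrite r1N0 gt_eqF.
Qed.

(** The Bellman inequality above [m], where the slopes vanish. The bound by [m + 1] amounts to
    [2 * r ^+ m.+1 <= 1]. *)
Lemma optimal_queue_le z : m%:Z < z -> optimal_queue <= `|z|%:~R.
Proof.
move=> mz; apply: (@le_trans _ _ (m%:R + 1)).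
  rewrite /optimal_queue /= -addrA lerD2l -mulrBl ler_pdivrMr // mul1r.
  by have := m_stop; lra.
by rewrite natr1 -[_%:R]/(_%:Z%:~R) ler_int; lia.
Qed.

(** Linear growth, so that any positive multiple of a quadratic eventually exceeds the slope. *)
Lemma slope_le (i : nat) :
  slope (m%:Z - i%:Z) <= i.+1%:R * ((1 + m%:R + 2 * r / (1 - r)) / (p * (1 - r))).
Proof.
set A := 2 * r / (1 - r); have A0 : 0 <= A by rewrite divr_ge0 ?mulr_ge0 // ltW.
have pr0 : 0 < p * (1 - r) by rewrite mulr_gt0.
have shape_le z : slope_shape z <= `|z|%:~R + A.
  case: z => n /=; last by rewrite lexx.
  rewrite lerD2l ler_pM2r ?invr_gt0 // ler_wpM2l //.
  by rewrite exprS ler_piMr // exprn_ile1 // ltW //; have := r1; lra.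
have shape_ge0 : 0 <= slope_shape m.
  by rewrite addr_ge0 // divr_ge0 ?mulr_ge0 ?exprn_ge0 // ltW.
have zi : `|m%:Z - i%:Z|%:~R <= m%:R + i%:R :> R.
  by rewrite intr_norm rmorphB (le_trans (ler_normB _ _)) ?normr_nat.
have i0 : 0 <= i%:R :> R by []; have m0 : 0 <= m%:R :> R by [].
rewrite /slope gerBl //.
rewrite mulrA ler_pM2r ?invr_gt0 //.
have := shape_le (m%:Z - i%:Z).
rewrite -natr1; have : 0 <= i%:R * (m%:R + A) by rewrite mulr_ge0 // addr_ge0.
lra.
Qed.

(* Subtracting a multiple of the quadratic u from the slope keeps the Bellman
   inequality, as r u(i + 1) <= u i, and makes the support finite. *)
Lemma truncated_slope (eta : R) : 0 < eta -> exists (L : nat) (sigma : nat -> R),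
  [/\ forall i, 0 <= sigma i, forall i, (L <= i)%N -> sigma i = 0 &
  forall z : int, optimal_queue - eta
    + p * (if z <= m%:Z then sigma (absz (m%:Z - z)%R) else 0)
    - r * p * (if z - 1 <= m%:Z then sigma (absz (m%:Z - (z - 1))%R) else 0) <= `|z|%:~R].
Proof.
move=> eta0; have rp0 : 0 <= r * p by rewrite mulr_ge0 // ltW.
have q0 : 0 <= `|optimal_queue| by [].
have m0 : 0 <= m%:R :> R by [].
(* With [w = i + L0] one has [(w + 1) ^+ 2 <= w ^+ 2 + 2 * w + w] and [3 * r <= w * (1 - r)], hence
   [r * u i.+1 <= u i]. *)
pose L0 : R := 1 + 3 * r / (1 - r).
have L01 : 1 <= L0 by rewrite lerDl divr_ge0 ?mulr_ge0 // ltW.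
have L00 : 0 <= L0 by exact: le_trans L01.
pose u (i : nat) : R := (i%:R + L0) ^+ 2.
have u_rec i : r * u i.+1 <= u i.
  rewrite /u -natr1 addrAC; set w := i%:R + L0.
  have w1 : 1 <= w by rewrite /w; have : 0 <= i%:R :> R by []; lra.
  have : 3 * r <= w * (1 - r).
    rewrite -ler_pdivrMr //; have : 0 <= i%:R :> R by [].
    by rewrite /w /L0; lra.
  move=> w3; have : 3 * r * w <= w * (1 - r) * w by rewrite ler_wpM2r //; lra.
  have : r * 1 <= r * w by rewrite ler_wpM2l.
  by rewrite !expr2; lra.
(* Bounds [u i.+1] wherever [|z| < optimal_queue]. This is the only region where the truncation
   costs something, and [eps] keeps that cost below [eta]. *)
pose U := (m%:R + `|optimal_queue| + 1 + L0) ^+ 2.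
have U0 : 0 <= U by exact: sqr_ge0.
pose eps := eta / (r * p * U + 1).
have den0 : 0 < r * p * U + 1 by rewrite ltr_pwDr // mulr_ge0.
have eps0 : 0 < eps by rewrite divr_gt0.
have epsU : r * p * (eps * U) <= eta.
  have -> : r * p * (eps * U) = eta * (r * p * U / (r * p * U + 1)).
    by rewrite /eps; field; rewrite gt_eqF.
  by rewrite ler_piMr ?(ltW eta0) // ler_pdivrMr //; lra.
pose B := (1 + m%:R + 2 * r / (1 - r)) / (p * (1 - r)).
have B0 : 0 <= B by rewrite divr_ge0 ?addr_ge0 ?divr_ge0 ?mulr_ge0 // ltW.
pose s i := slope (m%:Z - i%:Z).
pose sigma i := Num.max 0 (s i - eps * u i).
have sigma_ge0 i : 0 <= sigma i by rewrite le_max lexx.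
have sigma_ge i : s i - eps * u i <= sigma i by rewrite le_max lexx orbT.
exists (Num.bound (B / eps)), sigma; split => // [i iL|z].
  apply/eqP; rewrite eq_le sigma_ge0 andbT ge_max lexx subr_le0.
  apply: (le_trans (slope_le i)); rewrite -/B.
  have i1 : 0 <= i.+1%:R :> R by [].
  have Bi : B <= eps * i.+1%:R.
    rewrite -ler_pdivrMl // mulrC; apply: (@le_trans _ _ (Num.bound (B / eps))%:R).
      by rewrite ltW // archi_boundP // divr_ge0 // ltW.
    by rewrite ler_nat (leq_trans iL).
  apply: (le_trans (ler_wpM2l i1 Bi)); rewrite mulrCA ler_pM2l // /u -expr2.
  have iL0 : i.+1%:R <= i%:R + L0 by rewrite -natr1 lerD2l.
  by rewrite ler_sqr ?nnegrE // (le_trans i1).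
have [mz|zm] := ltP m%:Z z.
  rewrite mulr0 addr0; have := optimal_queue_le mz.
  case: ifP => _; last by rewrite mulr0; lra.
  have : 0 <= r * p * sigma (absz (m%:Z - (z - 1))%R) by rewrite mulr_ge0.
  lra.
have [-> ->] := distance_to_threshold zm.
set i := absz _ => zi zi1 i_le.
have sE : s i = slope z by rewrite /s zi.
have sE1 : s i.+1 = slope (z - 1) by rewrite /s zi1.
have := slope_bellman_eq zm; rewrite -sE -sE1 => qE.
have si1 : r * p * (s i.+1 - eps * u i.+1) <= r * p * sigma i.+1 by rewrite ler_wpM2l.
(* Where [sigma i] is positive, [u_rec] absorbs the correction. Where it is 0, either [|z|] already
   exceeds the average cost or [U] bounds the error. *)
have [pos|npos] := ltP 0 (s i - eps * u i).
  have -> : sigma i = s i - eps * u i by rewrite /sigma max_r // ltW.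
  have : p * eps * (r * u i.+1) <= p * eps * u i by rewrite ler_wpM2l ?u_rec // mulr_ge0 ?(ltW p0) ?(ltW eps0).
  lra.
have -> : sigma i = 0 by rewrite /sigma max_l.
have si0 : 0 <= p * s i by rewrite mulr_ge0 ?slope_ge0 // ltW.
rewrite mulr0 addr0; have [qz|zq] := leP optimal_queue `|z|%:~R.
  have : 0 <= r * p * sigma i.+1 by rewrite mulr_ge0.
  lra.
have uU : u i.+1 <= U.
  rewrite /u /U ler_sqr ?nnegrE; [|exact: addr_ge0|by do 2![apply: addr_ge0 => //]; exact: addr_ge0].
  rewrite lerD2r -natr1 lerD2r; apply: (@le_trans _ _ (m%:R + `|z|%:~R)).
    by rewrite -[_%:R]/(_%:Z%:~R) -[m%:R]/(_%:Z%:~R) -intrD ler_int.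
  by rewrite lerD2l; apply: (le_trans (ltW zq)); rewrite ler_norm.
have : r * p * (eps * u i.+1) <= r * p * (eps * U).
  by rewrite ler_wpM2l // ler_pM2l.
lra.
Qed.

End RelativeValue.

(** * Drop policies *)

Lemma potential_succ (R : realType) L (sigma : nat -> R) (m : nat) (z : int) :
  (forall i, (L <= i)%N -> sigma i = 0) ->
  potential L sigma m (z + 1) = potential L sigma m z +
    (if z <= m%:Z then sigma (absz (m%:Z - z)%R) else 0).
Proof.
move=> sigma0; rewrite /potential.
have -> : \sum_(i < L) sigma i * (m%:Z - i%:Z < z + 1)%R%:R =
    \sum_(i < L) (sigma i * (m%:Z - i%:Z < z)%R%:R + sigma i * (m%:Z - i%:Z == z)%:R).
  apply: eq_bigr => i _; rewrite -mulrDr -natrD; congr (_ * _%:R).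
  by case: (ltgtP (m%:Z - i%:Z) z) => ?; lia.
rewrite big_split /=; congr (_ + _); case: ifP => [zm|/negbT zm]; last first.
  rewrite big1 // => i _; rewrite (_ : _ == z = false) ?mulr0 //; apply/eqP => e.
  by move: zm; rewrite -e gerBl.
have [iL|iL] := ltnP (absz (m%:Z - z)%R) L; last first.
  rewrite sigma0 // big1 // => i _; case: eqVneq => [e|]; last by rewrite mulr0.
  by move: iL; rewrite -e => ?; exfalso; have := ltn_ord i; lia.
rewrite (bigD1 (Ordinal iL)) //= big1 ?addr0 => [|i ii].
  by rewrite (_ : _ == z) ?mulr1 //; lia.
rewrite (_ : _ == z = false) ?mulr0 //; apply/eqP => e; move/eqP: ii; apply.
by apply: val_inj => /=; lia.
Qed.

Lemma mean_arrivals_potential (R : realType) (lambdaR lambdaB : R) L (sigma : nat -> R) (m : nat) (z : int) :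
  (forall i, (L <= i)%N -> sigma i = 0) ->
  mean_arrivals lambdaR lambdaB (fun aR aB => potential L sigma m (z + aR%:Z - aB%:Z)) =
  potential L sigma m z
  + lambdaR * (1 - lambdaB) * (if z <= m%:Z then sigma (absz (m%:Z - z)%R) else 0)
  - (1 - lambdaR) * lambdaB * (if z - 1 <= m%:Z then sigma (absz (m%:Z - (z - 1))%R) else 0).
Proof.
move=> sigma0; rewrite mean_arrivalsE /=.
have -> : z + 1 - 1 = z by lia.
have -> : z + 0 - 0 = z by lia.
have -> : z + 1 - 0 = z + 1 by lia.
have -> : z + 0 - 1 = z - 1 by lia.
rewrite potential_succ //.
have := @potential_succ R L sigma m (z - 1) sigma0; rewrite subrK => e.
have -> := canRL (addrK _) (esym e).
by move: (if z <= _ then _ else _) (if z - 1 <= _ then _ else _) => s s'; ring.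
Qed.

Lemma sum_actions_dirac (R : realType) h (aR aB sR sB : bool) (i j : nat) :
  (i <= red_queue h + aR)%N -> (j <= blue_queue h + aB)%N ->
  sum_actions h aR aB (fun u => (u == (sR, sB, i, j))%:R) = 1 :> R.
Proof.
move=> iq jq; rewrite /sum_actions (bigD1 sR) //= (bigD1 sB) //=.
rewrite (bigD1 (Ordinal (iq : (i < (red_queue h + aR).+1)%N))) //=.
rewrite (bigD1 (Ordinal (jq : (j < (blue_queue h + aB).+1)%N))) //= eqxx.
rewrite big1 ?addr0 => [|k kj]; last first.
  by rewrite -val_eqE /= in kj; rewrite !xpair_eqE (negbTE kj) andbF.
rewrite big1 ?addr0 => [|k kj]; last first.
  rewrite big1 // => l _.
  by rewrite -val_eqE /= in kj; rewrite !xpair_eqE (negbTE kj) andbF.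
rewrite big1 ?addr0 => [|k kj]; last first.
  rewrite big1 // => l _; rewrite big1 // => l' _.
  by rewrite !xpair_eqE (negbTE kj) andbF.
rewrite big1 ?addr0 // => k kj.
rewrite big1 // => l _; rewrite big1 // => l' _; rewrite big1 // => l'' _.
by rewrite !xpair_eqE (negbTE kj).
Qed.

Section DropPolicy.
Context {R : realType}.
Variables (lambdaR lambdaB : R).
Hypotheses (lR01 : 0 <= lambdaR <= 1) (lB01 : 0 <= lambdaB <= 1).
Variables (m : nat) (delta : nat -> R).
Hypothesis deltaP : threshold_probabilities m delta.

Local Notation pol := (drop_policy delta).
Local Notation E d n := (cond_expect lambdaR lambdaB pol d n).

Lemma drop_policyP : is_policy pol.
Proof.
have [delta01 _ _] := deltaP; move=> d h aR aB; rewrite /drop_policy.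
set both := (0 < _)%N && _; set p := (if _ then _ else _).
have p01 : 0 <= p <= 1 by rewrite /p; case: ifP; rewrite ?delta01 ?lexx ?ler01.
have both_feasible : (both <= red_queue h + aR)%N && (both <= blue_queue h + aB)%N.
  rewrite /both; case: (ltnP 0 (red_queue h + aR)) => //= x0.
  by case: (ltnP 0 (blue_queue h + aB)) => //= y0; apply/andP.
have p_drop : p != 0 -> [/\ blue_queue h = 0%N, aR = true & aB = false].
  by rewrite /p; case: ifP => [/and3P[/eqP -> -> /negbTE ->]|]; rewrite ?eqxx.
have drop_feasible : p != 0 -> feasible h aR aB (both, both, 1%N, 0%N).
  move=> /p_drop[bq -> aB0]; rewrite /feasible /both /sent_red /sent_blue /dropped_red /dropped_blue /=.
  by rewrite bq aB0 andbF !addn0 add0n leq_addl.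
split.
- by move=> u; case/andP: p01 => ? ?; rewrite addr_ge0 // mulr_ge0 // subr_ge0.
- move=> u; case: (eqVneq u (both, both, 0%N, 0%N)) => [->|_].
    by rewrite /feasible /sent_red /sent_blue /dropped_red /dropped_blue /= !addn0 both_feasible.
  rewrite mulr0 add0r; case: eqVneq => [->|_]; last by rewrite mulr0.
  by have [->|/drop_feasible ->//] := eqVneq p 0; rewrite mul0r.
have sumE c c' (u u' : action) : sum_actions h aR aB (fun v => c * (v == u)%:R + c' * (v == u')%:R) =
    c * sum_actions h aR aB (fun v => (v == u)%:R) + c' * sum_actions h aR aB (fun v => (v == u')%:R) :> R.
  rewrite /sum_actions; do 4![rewrite !big_distrr -big_split /=; apply: eq_bigr => ? _].
  by [].
rewrite sumE sum_actions_dirac //.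
have [->|p0] := eqVneq p 0; first by rewrite mul0r addr0 subr0 mul1r.
rewrite sum_actions_dirac ?mulr1 ?subrK //.
by have [_ -> _] := p_drop p0; rewrite addn1.
Qed.

(** * Trajectories of a threshold policy *)

Definition reachable (h : history) : Prop :=
  [/\ conserving h, all (fun s => sent_red (act s) == sent_blue (act s)) h,
      total dropB h = 0%N, (red_queue h <= m)%N &
      red_queue h = 0%N \/ blue_queue h = 0%N].

Definition net_queue (h : history) : int := (red_queue h)%:Z - (blue_queue h)%:Z.

(** On reachable histories the policy is deterministic: [delta] is evaluated at most at [m], where
    it takes only the values 0 and 1. *)
Lemma drop_policy_support d h aR aB u : reachable h -> pol d h aR aB u != 0 ->
  let both := (0 < red_queue h + aR)%N && (0 < blue_queue h + aB)%N in
  let full := [&& blue_queue h == 0%N, red_queue h == m, aR & ~~ aB] in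
  u = (both, both, nat_of_bool full, 0%N).
Proof.
have [delta01 delta0 delta1] := deltaP.
move=> [_ _ _ qm _]; rewrite /drop_policy; set both := (0 < _)%N && _ => /=.
set p := (if _ then _ else _).
have pE : p = [&& blue_queue h == 0%N, red_queue h == m, aR & ~~ aB]%:R.
  rewrite /p; case: (blue_queue h == 0%N) => //=; case: (aR && ~~ aB); last by rewrite andbF.
  rewrite andbT; have [->|qNm] := eqVneq (red_queue h) m; first exact: delta1.
  by rewrite delta0 // ltn_neqAle qNm.
rewrite pE; case: [&& _, _, _ & _].
  by rewrite subrr mul0r add0r mul1r pnatr_eq0 eqb0 negbK => /eqP ->.
by rewrite subr0 mul0r addr0 mul1r pnatr_eq0 eqb0 negbK => /eqP ->.
Qed.

(** Simultaneous departures preserve the difference of the queues, and a red packet is dropped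
    exactly when this difference would pass [m]. *)
Lemma reachable_rcons d h aR aB u : reachable h -> pol d h aR aB u != 0 ->
  reachable (rcons h (aR, aB, u)) /\
  net_queue (rcons h (aR, aB, u)) = Num.min (net_queue h + aR%:Z - aB%:Z) m%:Z.
Proof.
move=> hr u0; have feas := pol_feasible drop_policyP u0.
have := drop_policy_support hr u0; case: hr => [hc hs hd qm q0] /= uE.
have := conserving_rcons hc feas; clear feas u0.
rewrite /reachable /net_queue all_rcons hs /conserving !red_queueE !blue_queueE !total_rcons hd.
move: hc qm q0 uE; rewrite /conserving red_queueE blue_queueE hd.
rewrite /sentR /sentB /dropR /dropB /arr_red /arr_blue /act /sent_red /sent_blue /dropped_red /dropped_blue /=.
move: (total arr_red h) (total arr_blue h) (total sentR h) (total sentB h) (total dropR h).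
move=> a b s s' k [c1 c2] qm q0 -> /= [c1' c2']; rewrite eqxx.
by case: aR aB c1' c2' => [|] [|] /= c1' c2'; split; try split => //; lia.
Qed.

Let fin d n : finitary (fun h => reachable h /\ size h = n) (E d n).
Proof.
apply: (finitary_cond_expect lR01 lB01 drop_policyP).
  by split; rewrite /conserving /red_queue /blue_queue /total ?big_nil //; left.
by move=> h aR aB u hr u0; have [] := reachable_rcons hr u0.
Qed.

Lemma cond_expect_net_queue d n (f : int -> R) :
  E d n.+1 (fun h => f (net_queue h)) = E d n (fun h =>
    mean_arrivals lambdaR lambdaB (fun aR aB => f (Num.min (net_queue h + aR%:Z - aB%:Z) m%:Z))).
Proof.
apply: (finitary_eq (fin d n)) => h [hr _].
apply: (next_slot_arrivals _ _ drop_policyP) => aR aB u u0.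
by have [_ ->] := reachable_rcons hr u0.
Qed.

Lemma net_queue_bounds h : reachable h ->
  [/\ net_queue h <= m%:Z, - (size h)%:Z <= net_queue h,
      `|net_queue h| = (red_queue h + blue_queue h)%N%:Z &
      (total sentB h + blue_queue h = total arr_blue h)%N].
Proof.
move=> [[_ c2] hs hd qm q0]; have := total_le_size arr_blue h.
move: c2 qm q0; rewrite /net_queue blue_queueE hd; move: (red_queue h) => x c2 qm q0 ?.
split; [lia|lia|case: q0 => ?; lia|lia].
Qed.

Lemma sent_red_total h : reachable h -> total sentR h = total sentB h.
Proof.
move=> [_ hs _ _ _]; rewrite /total big_seq [RHS]big_seq; apply: eq_bigr => s /(allP hs).
by rewrite /sentR /sentB => /eqP ->.
Qed.

(** Red and blue always leave together and the policy ignores [d], so both routings give the same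
    joint law; the entropy is 1 for every [n]. *)
Lemma drop_policy_anonymous : perfect_anonymity lambdaR lambdaB pol.
Proof.
rewrite /perfect_anonymity.
suff -> : (fun n => cond_entropy (@joint_pmf R lambdaR lambdaB pol n)) = fun=> 1 by exact: cvg_cst.
apply: funext => n.
have E_dE f : E true n f = E false n f by elim: n f => [//|n IH] f /=; exact: IH.
have joint_dE (y : n.-tuple _) :
    joint_pmf lambdaR lambdaB pol true y = joint_pmf lambdaR lambdaB pol false y.
  rewrite /joint_pmf E_dE; congr (_ * _); apply: (finitary_eq (fin false n)) => h [[_ hs _ _ _] _].
  congr (_ == _)%:R; apply/eq_in_map => s /(allP hs) /eqP e.
  by rewrite /view e.
rewrite /cond_entropy -[RHS](joint_pmf_total lR01 lB01 drop_policyP n) -sumrN.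
apply: eq_bigr => x _; rewrite -sumrN; apply: eq_bigr => y _.
rewrite big_bool /= joint_dE.
have -> : joint_pmf lambdaR lambdaB pol x y = joint_pmf lambdaR lambdaB pol false y.
  by case: x; rewrite ?joint_dE.
set a := joint_pmf _ _ _ _ _.
have [->|a0] := eqVneq a 0; first by rewrite mul0r oppr0.
have -> : a / (a + a) = 2^-1 by rewrite -mulr2n -[a *+ 2]mulr_natr invfM mulrA divff // mul1r.
by rewrite /log2 lnV ?posrE // mulNr divff ?mulrN1 ?opprK // gt_eqF // ln_gt0 // ltr1n.
Qed.

(** Steps have size at most 1 and the upward drift contributes at most [2 * m], as [z <= m]. Linear
    growth of the second moment makes the mean blue queue [o(n)], even if the chain is far from its
    steady state. *)
Lemma net_queue_second_moment d n : lambdaB <= lambdaR ->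
  E d n (fun h => (net_queue h)%:~R ^+ 2) <= n%:R * (2 * m%:R + 1).
Proof.
move=> lBR; elim: n => [|n IH].
  by rewrite /= /net_queue /red_queue /blue_queue !big_nil subrr expr0n mul0r.
rewrite (cond_expect_net_queue d n (fun z => z%:~R ^+ 2)).
apply: (@le_trans _ _ (E d n (fun h => (net_queue h)%:~R ^+ 2 + (2 * m%:R + 1)))); last first.
  by rewrite (finitaryD (fin d n)) (cond_expect_cst lR01 lB01 drop_policyP) -(natr1 n) [(n%:R + 1) * _]mulrDl mul1r lerD2r.
apply: (finitary_le (fin d n)) => h [/net_queue_bounds[zm _ _ _] _].
move: (net_queue h) zm => z zm.
have zmR : z%:~R <= m%:R :> R by rewrite -[m%:R]/(m%:Z%:~R) ler_int.
apply: (@le_trans _ _ (mean_arrivals lambdaR lambdaB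
  (fun aR aB => z%:~R ^+ 2 + 2 * z%:~R * (aR%:R - aB%:R) + 1))).
  apply: ler_sum => aR _; apply: ler_sum => aB _; rewrite ler_wpM2l ?bernoulli_weight_ge0 //.
  case: (leP (z + aR%:Z - aB%:Z) m%:Z) => [_|zm1].
    by rewrite rmorphB rmorphD /=; case: aR aB => [|] [|] /=; nra.
  have [-> -> ->] : [/\ z = m%:Z, aR = true & aB = false].
    by case: aR aB zm1 => [|] [|] /= zm1; split => //; lia.
  by rewrite /= subr0 mulr1; have : 0 <= m%:R :> R by []; lra.
rewrite mean_arrivalsE /=.
have -> : forall x : R, lambdaR * lambdaB * (x ^+ 2 + 2 * x * (1 - 1) + 1)
  + lambdaR * (1 - lambdaB) * (x ^+ 2 + 2 * x * (1 - 0) + 1)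
  + (1 - lambdaR) * lambdaB * (x ^+ 2 + 2 * x * (0 - 1) + 1)
  + (1 - lambdaR) * (1 - lambdaB) * (x ^+ 2 + 2 * x * (0 - 0) + 1)
  = x ^+ 2 + (2 * (x * (lambdaR - lambdaB)) + 1) by move=> x; ring.
rewrite lerD2l lerD2r ler_pM2l //.
apply: (@le_trans _ _ (m%:R * (lambdaR - lambdaB))); first by rewrite ler_wpM2r ?subr_ge0.
by rewrite ler_piMr //; case/andP: lR01 => ? ?; case/andP: lB01 => ? ?; lra.
Qed.

Lemma mean_sent_blueE n : mean_sent_blue lambdaR lambdaB pol n =
  (n%:R * lambdaB - expect lambdaR lambdaB pol n (fun h => (blue_queue h)%:R)) / n%:R.
Proof.
rewrite /mean_sent_blue; congr (_ / _); rewrite /expect !big_bool /=.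
have sentE d : E d n (fun h => (\sum_(s <- h) sent_blue (act s))%:R) =
    n%:R * lambdaB - E d n (fun h => (blue_queue h)%:R).
  rewrite -(cond_expect_total_arr_blue lR01 lB01 drop_policyP d) -(finitaryB (fin d n)).
  apply: (finitary_eq (fin d n)) => h [/net_queue_bounds[_ _ _ <-] _].
  by rewrite natrD addrK.
by rewrite !sentE; field.
Qed.

Lemma mean_sent_red_blue n :
  mean_sent_red lambdaR lambdaB pol n = mean_sent_blue lambdaR lambdaB pol n.
Proof.
rewrite /mean_sent_red /mean_sent_blue /expect; congr (_ * _ / _).
apply: eq_bigr => d _; apply: (finitary_eq (fin d n)) => h [hr _].
by have := sent_red_total hr; rewrite /total /sentR /sentB => ->.
Qed.

Lemma drop_policy_max_throughput : lambdaB <= lambdaR ->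
  max_throughput lambdaR lambdaB pol.
Proof.
move=> lBR.
suff cv : (mean_sent_blue lambdaR lambdaB pol n @[n --> \oo] --> lambdaB)%classic.
  split=> //; suff -> : mean_sent_red lambdaR lambdaB pol = mean_sent_blue lambdaR lambdaB pol by [].
  by apply: funext => n; exact: mean_sent_red_blue.
apply/cvgrPdist_le => e e0.
pose c : R := 2 * m%:R + 1.
have c0 : 0 < c by rewrite ltr_wpDl ?mulr_ge0.
(* y <= t y^2 + 1/(4t), and the second moment of y is at most c n *)
pose t := e / (2 * c).
have t0 : 0 < t by rewrite divr_gt0 ?mulr_gt0.
have bq d n : 0 <= E d n (fun h => (blue_queue h)%:R) <= t * (n%:R * c) + (4 * t)^-1.
  apply/andP; split.
    rewrite -(cond_expect_cst lR01 lB01 drop_policyP d n 0).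
    exact: (finitary_le (fin d n)).
  apply: (@le_trans _ _ (E d n (fun h => t * (net_queue h)%:~R ^+ 2 + (4 * t)^-1))).
    apply: (finitary_le (fin d n)) => h [/net_queue_bounds[_ _ zE _] _].
    have -> : (net_queue h)%:~R ^+ 2 = (red_queue h + blue_queue h)%:R ^+ 2 :> R.
      by rewrite -real_normK ?num_real // -intr_norm zE.
    apply: (@le_trans _ _ (red_queue h + blue_queue h)%:R); first by rewrite ler_nat leq_addl.
    set y := _%:R; have : 0 <= (2 * t * y - 1) ^+ 2 / (4 * t) by rewrite divr_ge0 ?sqr_ge0 // mulr_ge0 // ltW.
    have -> : (2 * t * y - 1) ^+ 2 / (4 * t) = t * y ^+ 2 - y + (4 * t)^-1.
      by field; rewrite gt_eqF.
    lra.
  rewrite (finitaryD (fin d n)) (cond_expect_cst lR01 lB01 drop_policyP) lerD2r.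
  by rewrite (finitaryZ (fin d n)) ler_pM2l // net_queue_second_moment.
exists (Num.bound ((2 * t * e)^-1)).+1 => // n /= nN.
have n0 : 0 < n%:R :> R by rewrite ltr0n (leq_trans _ nN).
have nbig : (2 * t * e)^-1 <= n%:R.
  apply: (le_trans (ltW (archi_boundP _))); first by rewrite ltW // invr_gt0 mulr_gt0 // mulr_gt0.
  by rewrite ler_nat ltnW.
rewrite mean_sent_blueE; set q := expect _ _ _ _ _.
have q0 : 0 <= q <= t * (n%:R * c) + (4 * t)^-1.
  have /andP[? ?] := bq true n; have /andP[? ?] := bq false n.
  by rewrite /q /expect big_bool /=; apply/andP; split; lra.
have -> : lambdaB - (n%:R * lambdaB - q) / n%:R = q / n%:R by field; rewrite gt_eqF.
rewrite ger0_norm; last by rewrite divr_ge0 //; case/andP: q0.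
rewrite ler_pdivrMr //; case/andP: q0 => _ /le_trans; apply.
have -> : t * (n%:R * c) = e * n%:R / 2 by rewrite /t; field; rewrite gt_eqF.
have : (4 * t)^-1 <= e / 2 * n%:R.
  rewrite -ler_pdivrMl ?divr_gt0 //; apply: le_trans nbig.
  rewrite le_eqVlt; apply/orP; left; apply/eqP; field.
  by rewrite !gt_eqF.
lra.
Qed.

(** The Poisson equation telescopes exactly. The remaining boundary term is at most the rise of the
    potential above 0, a sum of [m + 1] slopes that does not depend on [N]. *)
Lemma queue_sum_le (r : R) :
  0 < lambdaR * (1 - lambdaB) -> 0 <= r < 1 ->
  r * (lambdaR * (1 - lambdaB)) = (1 - lambdaR) * lambdaB ->
  r ^+ m.+1 <= 2^-1 -> (forall n, (0 < n <= m)%N -> 2^-1 <= r ^+ n) ->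
  exists A : R, forall d N,
    \sum_(n < N) E d n (fun h => (red_queue h + blue_queue h)%:R) <= N%:R * optimal_queue r m + A.
Proof.
set p := lambdaR * _ => p0 r01 rp stop cont.
have s0 := slope_ge0 p0 r01 stop cont.
exists (\sum_(i < m.+1) slope p r m (m%:Z - i%:Z)) => d N.
(* Within [N] slots the walk and its next step stay in [[-(N + 1), m + 1]], so cutting the slopes at
   [L] is invisible. *)
pose L := (N + m.+2)%N.
pose sigma i := if (i < L)%N then slope p r m (m%:Z - i%:Z) else 0.
have sigma0 i : (L <= i)%N -> sigma i = 0 by rewrite /sigma ltnNge => ->.
have sigma_ge0 i : 0 <= sigma i by rewrite /sigma; case: ifP.
have sigmaE (z : int) : z <= m%:Z -> - (N.+1)%:Z <= z ->
    (if z <= m%:Z then sigma (absz (m%:Z - z)%R) else 0) = slope p r m z.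
  move=> zm zN; have [_ _ e _ _] := distance_to_threshold zm.
  by rewrite zm /sigma e ifT //; rewrite /L; lia.
pose g (z : int) := potential L sigma m%:Z z.
(* The zero slope at [m] hides the truncation by [Num.min], so the free walk may be used. *)
have gm1 : g (m%:Z + 1) = g m%:Z.
  have mN : - (N.+1)%:Z <= m%:Z by clear; lia.
  by rewrite /g potential_succ // (sigmaE _ (lexx _) mN) /slope lexx subrr mul0r addr0.
have step n : (n <= N)%N -> \sum_(k < n) E d k (fun h => (red_queue h + blue_queue h)%:R) =
    n%:R * optimal_queue r m + E d n (fun h => g (net_queue h)) - g 0.
  elim: n => [_|n IH nN].
    by rewrite big_ord0 mul0r add0r /= /net_queue /red_queue /blue_queue !big_nil subrr.
  rewrite big_ord_recr /= (IH (ltnW nN)).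
  have -> : E d n (next_slot lambdaR lambdaB pol d (fun h => g (net_queue h))) =
      E d n.+1 (fun h => g (net_queue h)) by [].
  rewrite cond_expect_net_queue.
  have -> : E d n (fun h => mean_arrivals lambdaR lambdaB (fun aR aB =>
      g (Num.min (net_queue h + aR%:Z - aB%:Z) m%:Z))) =
      E d n (fun h => (g (net_queue h) + (red_queue h + blue_queue h)%:R) - optimal_queue r m).
    apply: (finitary_eq (fin d n)) => h [hr hn].
    have [zm zn zE _] := net_queue_bounds hr.
    rewrite -[(_ + _)%:R]/((_ + _)%N%:Z%:~R) -zE.
    move: (net_queue h) zm zn {zE} => z zm; rewrite hn => zn.
    transitivity (mean_arrivals lambdaR lambdaB (fun aR aB => g (z + aR%:Z - aB%:Z))).
      apply: eq_bigr => aR _; apply: eq_bigr => aB _; congr (_ * _).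
      case: (leP (z + aR%:Z - aB%:Z) m%:Z) => // zm1; rewrite -gm1; congr g.
      by case: aR aB zm1 => [|] [|] /=; lia.
    rewrite /g mean_arrivals_potential // !sigmaE //; [|lia|lia|lia].
    rewrite (slope_bellman_eq p0 r01 stop zm) rp -/p; ring.
  rewrite (finitaryB (fin d n)) (finitaryD (fin d n)) (cond_expect_cst lR01 lB01 drop_policyP).
  rewrite -(natr1 n); ring.
rewrite (step N (leqnn N)) -addrA lerD2l.
apply: (@le_trans _ _ (\sum_(i < L) sigma i - g 0)).
  rewrite lerD2r -[leRHS](cond_expect_cst lR01 lB01 drop_policyP d N).
  by apply: (finitary_le (fin d N)) => h _; exact: potential_le.
rewrite /g /potential -sumrB (bigID (fun i : 'I_L => (i < m.+1)%N)) /=.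
rewrite [X in _ + X <= _]big1 ?addr0 => [|i im]; last first.
  by rewrite (_ : _ < 0) ?mulr1 ?subrr //; lia.
have mL : (m.+1 <= L)%N by rewrite /L; lia.
rewrite (big_ord_widen L (fun i => slope p r m (m%:Z - i%:Z)) mL).
apply: ler_sum => i im; rewrite /sigma ltn_ord lerBlDr lerDl mulr_ge0 //.
Qed.

End DropPolicy.

(** * Optimality *)

Section Optimality.
Context {R : realType}.
Variables (lambdaR lambdaB : R) (m : nat).
Hypotheses (hB : 0 <= lambdaB) (hBR : lambdaB < lambdaR) (hR : lambdaR <= 1).

Local Notation p := (lambdaR * (1 - lambdaB)).
Local Notation r := (rho lambdaR lambdaB).

Lemma arrival_rates01 : 0 <= lambdaR <= 1 /\ 0 <= lambdaB <= 1.
Proof. by move: hB hBR hR; split; apply/andP; split; lra. Qed.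

Lemma up_rate_gt0 : 0 < p.
Proof. by move: hB hBR hR => *; apply: mulr_gt0; lra. Qed.

Lemma rho_up_rate : r * p = (1 - lambdaR) * lambdaB.
Proof. by rewrite /rho mulrC mulrA mulrAC divff ?gt_eqF ?up_rate_gt0 // mul1r mulrC. Qed.

Lemma rho01 : 0 <= r < 1.
Proof.
move: hB hBR hR => ? ? ?; rewrite /rho divr_ge0 ?mulr_ge0 //=; [|lra..].
by rewrite ltr_pdivrMr ?up_rate_gt0 // mul1r; lra.
Qed.

Hypothesis m_stop : r ^+ m.+1 <= 2^-1.
Hypothesis m_continue : forall n, (0 < n <= m)%N -> 2^-1 <= r ^+ n.

Local Notation q := (optimal_queue r m).

(** Averaging the coupled bound over the two choices of [d] yields the total queue. The four
    quarters of [eta] pay for the truncation of the slopes, [eps * S2], the constants and the blue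
    drops. *)
Lemma mean_queue_ge (pol : policy (R := R)) (eta : R) :
  admissible lambdaR lambdaB pol -> 0 < eta ->
  (\forall N \near \oo, q - eta <= mean_queue lambdaR lambdaB pol N)%classic.
Proof.
move=> [polP [_ cvB] anon] eta0; have [lR01 lB01] := arrival_rates01.
have eta4 : 0 < eta / 4 by rewrite divr_gt0.
have [L [sigma [sigma_ge0 sigma0 slopeP]]] :=
  truncated_slope up_rate_gt0 rho01 m_stop m_continue eta4.
have bellman z : q - eta / 4 +
    mean_arrivals lambdaR lambdaB (fun aR aB => potential L sigma m (z + aR%:Z - aB%:Z)) <=
    `|z|%:~R + potential L sigma m z.
  rewrite mean_arrivals_potential //; have := slopeP z; rewrite rho_up_rate.
  by move: (if z <= _ then _ else _) (if z - 1 <= _ then _ else _) => s s'; lra.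
set S1 := \sum_(i < L) sigma i; set S2 := \sum_(i < L) sigma i ^+ 2.
have S10 : 0 <= S1 by exact: sumr_ge0.
have S20 : 0 <= S2 by apply: sumr_ge0 => i _; exact: sqr_ge0.
pose eps := eta / 4 / (S2 + 1).
have eps0 : 0 < eps by rewrite divr_gt0 // ltr_wpDl.
have epsS : eps * S2 <= eta / 4.
  rewrite /eps mulrAC ler_pdivrMr ?ltr_wpDl // ler_wpM2l ?ltW //; lra.
set c := L%:R / (4 * eps).
have c0 : 0 <= c by rewrite divr_ge0 // mulr_ge0 // ltW.
pose Ex := expect lambdaR lambdaB pol.
pose D n := Ex n (fun h => (total dropB h)%:R).
have fin d n := finitary_conserving lR01 lB01 polP d n.
have ExE n (f g : history -> R) : Ex n (fun h => f h + g h) = Ex n f + Ex n g.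
  by rewrite /Ex /expect !big_bool /= !(finitaryD (fin _ _)); ring.
have sumE N : N%:R * (q - eta / 4) <=
    \sum_(n < N) Ex n (fun h => (red_queue h + blue_queue h)%:R)
    + (S1 + S1 * D N) + N%:R * (eps * S2) + c * (1 + D N).
  have H d := queue_sum_ge lR01 lB01 polP (same_view_of_anonymity lR01 lB01 polP anon d)
    sigma_ge0 bellman N eps0.
  have -> : \sum_(n < N) Ex n (fun h => (red_queue h + blue_queue h)%:R) =
     2^-1 * \sum_(n < N) (cond_expect lambdaR lambdaB pol true n (fun h => (red_queue h)%:R)
        + cond_expect lambdaR lambdaB pol false n (fun h => (blue_queue h)%:R))
     + 2^-1 * \sum_(n < N) (cond_expect lambdaR lambdaB pol false n (fun h => (red_queue h)%:R)
        + cond_expect lambdaR lambdaB pol true n (fun h => (blue_queue h)%:R)).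
    rewrite !big_distrr -big_split; apply: eq_bigr => n _ /=.
    have -> : (fun h => (red_queue h + blue_queue h)%:R) =
        (fun h => (red_queue h)%:R + (blue_queue h)%:R) :> (history -> R).
      by apply: funext => h; rewrite natrD.
    by rewrite ExE /Ex /expect !big_bool /=; ring.
  have := H true; have := H false; rewrite /= -/S1 -/S2 -/c.
  rewrite /D /Ex /expect big_bool /=; lra.
(* Blue packets dropped and sent number at most the arrivals, so throughput [lambdaB] leaves [o(n)]
   drops. *)
have dropE N : D N <= N%:R * (lambdaB - mean_sent_blue lambdaR lambdaB pol N).
  case: N => [|N]; first by rewrite mul0r /D /Ex /expect big_bool /= /total !big_nil addr0 mulr0.
  have N0 : N.+1%:R != 0 :> R by rewrite pnatr_eq0.
  rewrite /mean_sent_blue mulrBr [_ * (_ / _)]mulrCA divff // mulr1.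
  have dropd d : cond_expect lambdaR lambdaB pol d N.+1 (fun h => (total dropB h)%:R) <=
      N.+1%:R * lambdaB -
      cond_expect lambdaR lambdaB pol d N.+1 (fun h => (\sum_(s <- h) sent_blue (act s))%:R).
    rewrite -(cond_expect_total_arr_blue lR01 lB01 polP d) -(finitaryB (fin d N.+1)).
    apply: (finitary_le (fin d N.+1)) => h [[_ hB'] _].
    by rewrite lerBrDr -natrD ler_nat addnC.
  rewrite /D /Ex /expect !big_bool; move: (dropd true) (dropd false) => /=; lra.
have D_ge0 N : 0 <= D N.
  have D0 d : 0 <= cond_expect lambdaR lambdaB pol d N (fun h => (total dropB h)%:R).
    rewrite -(cond_expect_cst lR01 lB01 polP d N 0).
    exact: (finitary_le (fin d N)).
  by rewrite /D /Ex /expect big_bool mulr_ge0 // addr_ge0.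
pose b : R := S1 + c + 1.
have b0 : 0 < b by rewrite ltr_wpDl // addr_ge0.
have etab : 0 < eta / 4 / b by rewrite divr_gt0.
have /cvgrPdist_le/(_ _ etab) nearB := cvB.
near=> N.
have N0 : 0 < N%:R :> R by rewrite ltr0n; near: N; exact: nbhs_infty_gt.
have bN : b <= eta / 4 * N%:R.
  rewrite -ler_pdivrMl // mulrC; apply: (le_trans (ltW (archi_boundP _))).
    by rewrite divr_ge0 // ltW.
  by rewrite ler_nat; near: N; exact: nbhs_infty_ge.
have bD : b * D N <= eta / 4 * N%:R.
  have : D N <= N%:R * (eta / 4 / b).
    apply: (le_trans (dropE N)); rewrite ler_pM2l //.
    by apply: (le_trans (ler_norm _)); near: N.
  move=> /(ler_wpM2l (ltW b0)) /le_trans; apply.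
  by rewrite le_eqVlt; apply/orP; left; apply/eqP; field; rewrite gt_eqF.
rewrite /mean_queue ler_pdivlMr // -/Ex.
have shift : \sum_(n < N) Ex n (fun h => (red_queue h + blue_queue h)%:R) <=
    \sum_(n < N) Ex n.+1 (fun h => (red_queue h + blue_queue h)%:R).
  have Q0 n : 0 <= Ex n (fun h => (red_queue h + blue_queue h)%:R).
    have Q0 d : 0 <= cond_expect lambdaR lambdaB pol d n (fun h => (red_queue h + blue_queue h)%:R).
      rewrite -(cond_expect_cst lR01 lB01 polP d n 0).
      exact: (finitary_le (fin d n)).
    by rewrite /Ex /expect big_bool mulr_ge0 // addr_ge0.
  have -> : \sum_(n < N) Ex n.+1 (fun h => (red_queue h + blue_queue h)%:R) =
      \sum_(n < N.+1) Ex n (fun h => (red_queue h + blue_queue h)%:R).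
    rewrite [RHS]big_ord_recl [X in _ = X + _](_ : _ = 0) ?add0r //.
    by rewrite /Ex /expect big_bool /= /red_queue /blue_queue !big_nil addr0 mulr0.
  by rewrite big_ord_recr lerDl.
have epsN : N%:R * (eps * S2) <= N%:R * (eta / 4) by rewrite ler_pM2l.
have := sumE N; have := D_ge0 N; rewrite /b in bN bD *; lra.
Unshelve. all: by end_near. Qed.

Lemma threshold_admissible delta : threshold_probabilities m delta ->
  admissible lambdaR lambdaB (drop_policy delta).
Proof.
move=> deltaP; have [lR01 lB01] := arrival_rates01; split.
- exact: drop_policyP deltaP.
- exact: (drop_policy_max_throughput lR01 lB01 deltaP (ltW hBR)).
- exact: (drop_policy_anonymous lR01 lB01 deltaP).
Qed.

Lemma threshold_mean_queue delta : threshold_probabilities m delta ->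
  (mean_queue lambdaR lambdaB (drop_policy delta) n @[n --> \oo] --> q)%classic.
Proof.
move=> deltaP; have [lR01 lB01] := arrival_rates01.
have [A upper] := queue_sum_le lR01 lB01 deltaP up_rate_gt0 rho01 rho_up_rate m_stop m_continue.
apply/cvgrPdist_le => e e0.
have lower := mean_queue_ge (threshold_admissible deltaP) e0.
near=> N; have N0 : 0 < N%:R :> R by rewrite ltr0n; near: N; exact: nbhs_infty_gt.
(* The upper bound is taken over [N + 1] terms, including the empty initial state, which adds one
   [q] to the constant [A]. *)
have AN : `|q| + `|A| <= e * N%:R.
  rewrite -ler_pdivrMl // mulrC; apply: (le_trans (ltW (archi_boundP _))).
    by rewrite divr_ge0 ?addr_ge0 // ltW.
  by rewrite ler_nat; near: N; exact: nbhs_infty_ge.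
rewrite distrC ler_distl; apply/andP; split; first by near: N.
rewrite /mean_queue ler_pdivrMr //.
have -> : \sum_(t < N) expect lambdaR lambdaB (drop_policy delta) t.+1
    (fun h => (red_queue h + blue_queue h)%:R) = \sum_(t < N.+1)
    expect lambdaR lambdaB (drop_policy delta) t (fun h => (red_queue h + blue_queue h)%:R).
  rewrite [RHS]big_ord_recl [X in _ = X + _](_ : _ = 0) ?add0r //.
  by rewrite /expect big_bool /= /red_queue /blue_queue !big_nil addr0 mulr0.
rewrite /expect -big_distrr /=; under eq_bigr do rewrite big_bool.
rewrite big_split /=; have := upper true N.+1; have := upper false N.+1.
have := ler_norm q; have := ler_norm A; rewrite -natr1; lra.
Unshelve. all: by end_near. Qed.

End Optimality.

Lemma le_limn_einf (R : realType) (u : nat -> R) (l : R) :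
  (forall e, 0 < e -> (\forall n \near \oo, l - e <= u n)%classic) ->
  (l%:E <= limn_einf (fun n => (u n)%:E))%E.
Proof.
move=> lu; apply/lee_addgt0Pr => e e0; rewrite -leeBlDr //.
rewrite limn_einf_lim; apply: lime_ge; first exact: is_cvg_einfs.
have [M _ HM] := lu e e0; exists M => // n /= Mn.
apply: le_ereal_inf_tmp => _ [k /= nk <-]; rewrite lee_fin; apply: HM => /=.
exact: leq_trans nk.
Qed.

Theorem proposition3 (R : realType) (lambdaR lambdaB : R)
    (hB : 0 <= lambdaB) (hBR : lambdaB < lambdaR) (hR : lambdaR <= 1) :
  exists m : nat,
    m%:Z = optimal_threshold (rho lambdaR lambdaB) /\
    forall delta : nat -> R, threshold_probabilities m delta ->
      minimizes_average_queue lambdaR lambdaB (drop_policy delta).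
Proof.
have [m [mE stop cont]] := optimal_thresholdP (rho01 hB hBR hR).
exists m; split=> // delta deltaP; split.
  exact: (threshold_admissible hB hBR hR deltaP).
exists (optimal_queue (rho lambdaR lambdaB) m).
  exact: (threshold_mean_queue hB hBR hR stop cont deltaP).
move=> pol' adm; apply: le_limn_einf => e e0.
exact: (mean_queue_ge hB hBR hR stop cont adm e0).
Qed.
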